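(* Let $K$ be a triangulation of a closed orientable PL 3-manifold, mapped to $\mathbb R^3$ with a generic permitted length configuration, and let $\mathcal C$ be an admissible subset of the edges of $K$. Put $f=\det(A|_{\mathcal C})$. Then the expression $$\frac{f}{\prod_{\text{over all edges}}l^2}\prod_{\text{over all tetrahedra}}6V,$$ where $l$ are the edge lengths and $V$ the volumes of the tetrahedra, does not change, or changes only its sign, under performing a $2\to3$ Pachner move in such a way that the new edge is added to the subset $\mathcal C$.
   Context: Setting. $K$ is a finite simplicial complex triangulating the closed oriented manifold, with a consistent orientation of all its tetrahedra. All vertices of $K$ are mapped to points of Euclidean space $\mathbb R^3$ (with its own fixed orientation); every edge acquires a Euclidean length and every tetrahedron is mapped affinely to a Euclidean tetrahedron of volume $V>0$; self-intersections between the images of tetrahedra are allowed. The resulting collection of lengths is called a permitted length configuration. ''Generic'' means: for vertex placements in the complement of a proper algebraic subset. Defect angles. For edge lengths near a permitted length configuration (not necessarily permitted), the defect angle $\omega_j$ around edge $j$ is, modulo $2\pi$, the algebraic sum of the interior dihedral angles at $j$ in the tetrahedra containing $j$, taken with sign $-$ for the tetrahedra that do not change their orientation under the map into $\mathbb R^3$, and with sign $+$ for the others. Matrix. $A=(\partial\omega_j/\partial l_k)$, with $j,k$ running over all edges, evaluated at the permitted configuration (each partial derivative is taken with all other edge lengths fixed). It is symmetric. $A|_{\mathcal C}$ is the submatrix with rows and columns in $\mathcal C$. A subset $\mathcal C$ of edges is admissible if, at generic permitted configurations, $A|_{\mathcal C}$ is nondegenerate and $|\mathcal C|=\operatorname{rank}A$.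 Move. A $2\to3$ Pachner move replaces two tetrahedra $ABCD$ and $ABCE$ with common 2-face $ABC$ by three tetrahedra $ABDE$, $BCDE$, $CADE$ with the new common edge $DE$, keeping the rest of the complex and the positions of the vertices in $\mathbb R^3$; the new edge gets the length equal to the Euclidean distance between the images of $D$ and $E$ (so that the defect angle around it is zero). After the move, the expression is computed for the new complex, with its own matrix $A_{\rm new}$ of derivatives of defect angles, with $\mathcal C$ replaced by $\mathcal C_{\rm new}=\mathcal C\cup\{DE\}$, and with products over all edges and all tetrahedra of the new complex. *)

(* Defs.v *)
From HB Require Import structures.
From mathcomp Require Import all_boot all_order all_algebra.
From mathcomp Require Import all_classical all_reals all_analysis.
From mathcomp Require mpoly.
From mathcomp Require Import finset ring lra.
Set Implicit Arguments.
Unset Strict Implicit.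
Unset Printing Implicit Defensive.
Import Order.TTheory GRing.Theory Num.Theory numFieldNormedType.Exports.
Local Open Scope ring_scope.

Section PiecewiseLinear.
Context {R : realType}.

Definition conv_hull (E : lmodType R) (s : seq E) : set E :=
  fun x => exists2 w : 'I_(size s) -> R,
    (forall i, 0 <= w i) /\ \sum_i w i = 1 & x = \sum_i w i *: s`_i.

Definition affine_on (E F : lmodType R) (Q : set E) (f : E -> F) : Prop :=
  forall x y t, Q x -> Q y -> 0 <= t <= 1 ->
    f (t *: x + (1 - t) *: y) = t *: f x + (1 - t) *: f y.

(* Such an f is automatically continuous (finitely many compact pieces), and
   its inverse is then piecewise affine on the images of the pieces. *)
Definition PL_homeomorphic (E F : lmodType R) (X : set E) (Y : set F) : Prop :=
  exists2 f : E -> F, set_bij X Y f &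
    exists P : seq (seq E),
      (forall x, X x <-> exists2 s, s \in P & conv_hull s x) /\
      (forall s, s \in P -> affine_on (conv_hull s) f).

End PiecewiseLinear.

Section Complexes.
Context {V : finType}.
Implicit Types (K : {set {set V}}) (o : V -> V -> V -> V -> bool).

Definition is_complex K : Prop :=
  [/\ set0 \notin K, (forall v, [set v] \in K) &
      forall s t : {set V}, s \in K -> t \subset s -> t != set0 -> t \in K].

Definition link K (v : V) : {set {set V}} :=
  [set s | [&& s != set0, v \notin s & v |: s \in K]].

Definition edges K : {set {set V}} := [set s in K | #|s| == 2%N].
Definition tetrahedra K : {set {set V}} := [set s in K | #|s| == 4%N].

(* Barycentric coordinates: the point of |K| with coordinates x lies in the
   relative interior of the simplex spanned by the support of x. *)
Definition realization (R : realType) K : set {ffun V -> R^o} :=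
  fun x => [/\ forall v, 0 <= x v, \sum_v x v = 1 &
               [set v | x v != 0] \in K].

(* [o a b c d] means that the ordering (a, b, c, d) of the vertices of the
   tetrahedron abcd is positive.  The first conditions say that odd
   permutations reverse the sign (adjacent transpositions generate S_4); the
   last one says that two tetrahedra sharing the face abc induce opposite
   orientations on it. *)
Definition consistent_orientation K o : Prop :=
  (forall a b c d, uniq [:: a; b; c; d] -> [set a; b; c; d] \in K ->
     [/\ o b a c d = ~~ o a b c d,
         o a c b d = ~~ o a b c d &
         o a b d c = ~~ o a b c d]) /\
  (forall a b c d e, uniq [:: a; b; c; d; e] ->
     [set a; b; c; d] \in K -> [set a; b; c; e] \in K ->
     o a b c e = ~~ o a b c d).

Definition pachner23_applicable K (a b c d e : V) : Prop :=
  [/\ uniq [:: a; b; c; d; e], [set a; b; c; d] \in K,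
      [set a; b; c; e] \in K & [set d; e] \notin K].

Definition pachner23 K (a b c d e : V) : {set {set V}} :=
  (K :\: [set [set a; b; c]; [set a; b; c; d]; [set a; b; c; e]])
  :|: [set [set d; e];
           [set a; d; e]; [set b; d; e]; [set c; d; e];
           [set a; b; d; e]; [set b; c; d; e]; [set c; a; d; e]].

(* A new tetrahedron such as abde and the removed tetrahedron abcd have the
   common outer face abd and must induce the same orientation on it, i.e. the
   ordering (a, b, d, e) is positive iff (a, b, d, c) was.  So the sign of a
   new ordering is the old sign after replacing e by the missing one, m, of
   a, b, c; see pachner23_orientation_consistent below. *)
Definition pachner23_orientation o (a b c d e : V) : V -> V -> V -> V -> bool :=
  fun w x y z =>
    let t := [:: w; x; y; z] in
    let m := if a \notin t then a else if b \notin t then b else c in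
    let r v := if v == e then m else v in
    if (d \in t) && (e \in t) then o (r w) (r x) (r y) (r z) else o w x y z.

End Complexes.
Arguments realization {V} R K.

(* Combinatorial manifold: every vertex link is a PL 2-sphere, i.e. PL
   homeomorphic to the boundary of a 3-simplex. *)
Definition closed_PL_3manifold (R : realType) (V : finType)
    (K : {set {set V}}) : Prop :=
  is_complex K /\
  forall v : V,
    PL_homeomorphic (realization R (link K v))
      (realization R [set s : {set 'I_4} | (s != set0) && (s != [set: 'I_4])]).

Section Geometry.
Context {R : realType} {V : finType}.
Implicit Types (K C : {set {set V}}) (o : V -> V -> V -> V -> bool)
  (p : V -> 'rV[R]_3) (l : {set V} -> R).

Definition dot (x y : 'rV[R]_3) : R := \sum_i x 0 i * y 0 i.
Definition edist (x y : 'rV[R]_3) : R := Num.sqrt (dot (x - y) (x - y)).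

Definition edge_length p (j : {set V}) : R :=
  if enum j is [:: u; v] then edist (p u) (p v) else 0.

Definition det4 p (a b c d : V) : R :=
  \det (\matrix_(i < 3) [:: p b - p a; p c - p a; p d - p a]`_i).

Definition volume p (T : {set V}) : R :=
  if enum T is [:: a; b; c; d] then `|det4 p a b c d| / 6 else 0.

Definition permitted K p : Prop := forall T, T \in tetrahedra K -> 0 < volume p T.

(* 1 if the map into R^3 preserves the orientation of T, -1 if it reverses it;
   for o alternating on T the enumeration order is irrelevant. *)
Definition orientation_sign o p (T : {set V}) : R :=
  if enum T is [:: a; b; c; d]
  then (-1) ^+ (~~ o a b c d) * Num.sg (det4 p a b c d) else 0.

(* Law of cosines: the scalar product of the edge vectors ux and uy, in terms
   of lengths. *)
Definition len_dot l (u x y : V) : R :=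
  (l [set u; x] ^+ 2 + l [set u; y] ^+ 2 - l [set x; y] ^+ 2) / 2.

(* Interior dihedral angle at the edge uv of a Euclidean tetrahedron uvxy with
   edge lengths l: the angle between the components of the vectors ux and uy
   orthogonal to uv (see dihedral_edge_length below).  The formula is symmetric
   under the exchange of u and v and of x and y. *)
Definition dihedral l (u v x y : V) : R :=
  let h := l [set u; v] ^+ 2 in
  let hx := len_dot l u v x in
  let hy := len_dot l u v y in
  acos ((h * len_dot l u x y - hx * hy) /
        (Num.sqrt (h * l [set u; x] ^+ 2 - hx ^+ 2) *
         Num.sqrt (h * l [set u; y] ^+ 2 - hy ^+ 2))).

Definition dihedral_at l (j T : {set V}) : R :=
  match enum j, enum (T :\: j) with
  | [:: u; v], [:: x; y] => dihedral l u v x y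
  | _, _ => 0
  end.

(* The real representative of the defect angle (which is defined modulo 2 pi)
   at lengths l near edge_length p; the orientation signs are locally constant
   and are those of the placement p. *)
Definition defect_angle K o p l (j : {set V}) : R :=
  \sum_(T in tetrahedra K | j \subset T)
    - orientation_sign o p T * dihedral_at l j T.

Definition set_length l (k : {set V}) (t : R) : {set V} -> R :=
  fun k' => if k' == k then t else l k'.

Definition defect_derivative K o p (j k : {set V}) : R :=
  derive1 (fun t : R => defect_angle K o p (set_length (edge_length p) k t) j)
    (edge_length p k).

(* The submatrix of (d omega_j / d l_k) with rows and columns in C. *)
Definition submatrix K o p C : 'M[R]_#|C| :=
  \matrix_(i, j) defect_derivative K o p (enum_val i) (enum_val j).

Definition defect_matrix K o p : 'M[R]_#|edges K| := submatrix K o p (edges K).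

Definition coordinates p : 'I_#|{: V * 'I_3}| -> R :=
  fun i => p (enum_val i).1 0 (enum_val i).2.

Definition algebraic (Z : set (V -> 'rV[R]_3)) : Prop :=
  exists S : set (mpoly.mpoly #|{: V * 'I_3}| R),
    forall p, Z p <-> forall q, S q -> mpoly.meval (coordinates p) q = 0.

Definition generically (P : (V -> 'rV[R]_3) -> Prop) : Prop :=
  exists2 Z : set (V -> 'rV[R]_3),
    algebraic Z /\ (exists p, ~ Z p) & forall p, ~ Z p -> P p.

End Geometry.

Definition admissible (R : realType) (V : finType) (K : {set {set V}})
    (o : V -> V -> V -> V -> bool) (C : {set {set V}}) : Prop :=
  C \subset edges K /\
  generically (fun p : V -> 'rV[R]_3 => permitted K p ->
    submatrix K o p C \in unitmx /\ #|C| = \rank (defect_matrix K o p)).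

Definition expression (R : realType) (V : finType) (K : {set {set V}})
    (o : V -> V -> V -> V -> bool) (C : {set {set V}}) (p : V -> 'rV[R]_3) : R :=
  \det (submatrix K o p C) / (\prod_(j in edges K) edge_length p j ^+ 2)
  * \prod_(T in tetrahedra K) (6 * volume p T).

Section MoveOrientation.
Context {V : finType} (K : {set {set V}}) (o : V -> V -> V -> V -> bool)
  (a b c d e : V) (K_complex : is_complex K)
  (o_consistent : consistent_orientation K o)
  (move : pachner23_applicable K a b c d e).

Let K' := pachner23 K a b c d e.
Let missing (T : {set V}) := if a \notin T then a else if b \notin T then b else c.
Let r T v := if v == e then missing T else v.
Let newtet (T : {set V}) := (d \in T) && (e \in T).

Let orientationE w x y z : pachner23_orientation o a b c d e w x y z =
  let T := [set w; x; y; z] in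
  if newtet T then o (r T w) (r T x) (r T y) (r T z) else o w x y z.
Proof.
have M v : (v \in [:: w; x; y; z]) = (v \in [set w; x; y; z]).
  by rewrite !inE !orbA.
by rewrite /pachner23_orientation /= /newtet /r /missing !M.
Qed.

Let card4 (w x y z : V) : uniq [:: w; x; y; z] -> #|[set w; x; y; z]| = 4%N.
Proof.
move=> U; have /= := card_uniqP U; rewrite -[RHS]/4%N => <-.
by apply: eq_card => v; rewrite !inE !orbA.
Qed.

Let set_eq4 (w x y z : V) (T : {set V}) : uniq [:: w; x; y; z] -> #|T| = 4%N ->
  w \in T -> x \in T -> y \in T -> z \in T -> [set w; x; y; z] = T.
Proof.
move=> U T4 wT xT yT zT; apply/eqP; rewrite eqEcard T4 card4 // andbT.
by rewrite !subUset !sub1set wT xT yT zT.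
Qed.

Let U5 : uniq [:: a; b; c; d; e]. Proof. by case: move. Qed.

Let old_notnew (T : {set V}) : T \in K -> ~~ newtet T.
Proof.
move=> TK; apply/negP => /andP[dT eT]; case: move => _ _ _ /negP; apply.
case: K_complex => _ _ /(_ T _ TK); apply.
  by rewrite subUset !sub1set dT eT.
by apply/set0Pn; exists d; rewrite !inE eqxx.
Qed.

Let oldP (T : {set V}) : #|T| = 4%N -> T \in K' -> ~~ newtet T ->
  [/\ T \in K, T != [set a; b; c; d] & T != [set a; b; c; e]].
Proof.
move=> T4; rewrite !inE => /orP[/andP[]|].
  by rewrite !negb_or => /andP[/andP[_ ->] ->] ->.
by rewrite -!orbA => /or4P[|||/or4P[]] /eqP->;
  rewrite /newtet !inE !eqxx !orbT.
Qed.

Let newP (T : {set V}) : #|T| = 4%N -> T \in K' -> newtet T ->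
  [/\ missing T \in [:: a; b; c], missing T \notin T &
      forall v, (v \in T) = (v \in [:: a; b; c; d; e]) && (v != missing T)].
Proof.
move=> T4 TK' nT.
have card3 (x y z : V) : (#|[set x; y; z]| <= 3)%N.
  apply: leq_trans (leq_of_leqif (leq_card_setU _ _)) _.
  by rewrite cards1 cards2; case: (_ != _).
have : T \in [:: [set a; b; d; e]; [set b; c; d; e]; [set c; a; d; e]].
  move: TK'; rewrite !inE => /orP[/andP[_ TK]|].
    by have := old_notnew TK; rewrite nT.
  rewrite -!orbA => /or4P[|||/or4P[]] /eqP E; rewrite E ?eqxx ?orbT //;
    move: T4; rewrite E; try by rewrite cards2; case: (_ != _).
  1-3: by move=> H; have := card3 a d e; have := card3 b d e; have := card3 c d e; rewrite H.
move=> HT; have := U5; rewrite /= !inE !negb_or -!andbA.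
move=> /and5P[ab ac ad ae] /and5P[bc bd be cd] /and3P[ce de _].
have N := (negbTE ab, negbTE ac, negbTE ad, negbTE ae, negbTE bc, negbTE bd,
  negbTE be, negbTE cd, negbTE ce, negbTE de).
have N' := (eq_sym b a, eq_sym c a, eq_sym c b).
move: HT; rewrite !inE => /or3P[]/eqP->; rewrite /missing !inE !eqxx ?N' ?N ?eqxx ?orbT /=;
  split; rewrite ?eqxx ?orbT ?N ?N' ?N // => v; rewrite !inE.
- case: (eqVneq v c) => [->|_]; first by rewrite ?(N', N, eqxx).
  by rewrite andbT; case: (v == a); case: (v == b); case: (v == c).
- case: (eqVneq v a) => [->|_]; first by rewrite ?(N', N, eqxx).
  by rewrite andbT; case: (v == a); case: (v == b); case: (v == c).
- case: (eqVneq v b) => [->|_]; first by rewrite ?(N', N, eqxx).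
  by rewrite andbT; case: (v == a); case: (v == b); case: (v == c).
Qed.

Let abcdK : [set a; b; c; d] \in K. Proof. by case: move. Qed.
Let abceK : [set a; b; c; e] \in K. Proof. by case: move. Qed.
Let Uabcd : uniq [:: a; b; c; d].
Proof. by have := @take_uniq _ [:: a; b; c; d; e] 4 U5. Qed.
Let Uabce : uniq [:: a; b; c; e].
Proof.
apply: subseq_uniq U5.
by apply: (@cat_subseq _ [:: a; b; c] [:: e] [:: a; b; c] [:: d; e]);
  rewrite ?subseq_refl // subseq_cons.
Qed.

Let good s := uniq s && ([set v in s] \in K).

Let good4 w x y z : good [:: w; x; y; z] =
  uniq [:: w; x; y; z] && ([set w; x; y; z] \in K).
Proof.
by congr (_ && (_ \in K)); apply/setP => v; rewrite !inE !orbA.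
Qed.

Let good_perm s t : perm_eq s t -> good t -> good s.
Proof.
move=> st; rewrite /good (perm_uniq st) => /andP[-> /=].
by congr (_ \in K); apply/setP => v; rewrite !inE (perm_mem st).
Qed.

Let alts w x y z : good [:: w; x; y; z] ->
  [/\ o x w y z = ~~ o w x y z, o w y x z = ~~ o w x y z &
      o w x z y = ~~ o w x y z].
Proof. by rewrite good4 => /andP[U inK]; apply: (proj1 o_consistent). Qed.

Let swaps w x y z : uniq [:: w; x; y; z] -> [set w; x; y; z] \in K ->
  [/\ o z x y w = ~~ o w x y z, o w z y x = ~~ o w x y z &
      o w x z y = ~~ o w x y z].
Proof.
move=> U inK; have G : good [:: w; x; y; z] by rewrite good4 U.
have P s : perm_eq s [:: w; x; y; z] -> good s by move/good_perm; apply.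
have G1 : good [:: w; x; z; y].
  by apply/P/permP => q /=; case: (q w) (q x) (q y) (q z) => [] [] [] [].
have G2 : good [:: w; z; x; y].
  by apply/P/permP => q /=; case: (q w) (q x) (q y) (q z) => [] [] [] [].
have G3 : good [:: z; w; x; y].
  by apply/P/permP => q /=; case: (q w) (q x) (q y) (q z) => [] [] [] [].
have G4 : good [:: z; x; w; y].
  by apply/P/permP => q /=; case: (q w) (q x) (q y) (q z) => [] [] [] [].
have [_ _ H0] := alts G.
have [_ H1 _] := alts G1.
have [H2 _ H2'] := alts G2.
have [_ H3 _] := alts G3.
have [_ _ H4] := alts G4.
by rewrite H4 H3 H2 H2' H1 H0; case: (o w x y z).
Qed.

Let rT (T : {set V}) : #|T| = 4%N -> T \in K' -> newtet T -> forall w x y z,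
  uniq [:: w; x; y; z] -> [set w; x; y; z] = T ->
  uniq [:: r T w; r T x; r T y; r T z] /\
  [set r T w; r T x; r T y; r T z] = [set a; b; c; d].
Proof.
move=> T4 TK' nT w x y z U E.
have [m1 m2 HT] := newP T4 TK' nT.
have rin v : v \in T -> r T v \in [set a; b; c; d].
  rewrite HT /r => /andP[].
  case: (eqVneq v e) => [_ _ _|ve + _].
    by move: m1; rewrite !inE => /or3P[]->; rewrite ?orbT.
  by rewrite !inE (negbTE ve) orbF !orbA.
have rinj : {in T &, injective (r T)}.
  move=> u v uT vT; rewrite /r; case: eqP => [->|_]; case: eqP => [->|_] //.
    by move=> H; rewrite H vT in m2.
  by move=> H; rewrite -H uT in m2.
have /and4P[wT xT yT zT] : [&& w \in T, x \in T, y \in T & z \in T].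
  by rewrite -E !inE !eqxx !orbT.
have UU : uniq [:: r T w; r T x; r T y; r T z].
  rewrite (map_inj_in_uniq (f := r T) (s := [:: w; x; y; z])) //.
  by move=> u v; rewrite !inE => /or4P[]/eqP-> /or4P[]/eqP->; apply: rinj.
by split=> //; apply: set_eq4; rewrite ?card4 ?rin.
Qed.

Let abcde := [:: a; b; c; d; e].

Let memT (w x y z : V) : [/\ w \in [set w; x; y; z], x \in [set w; x; y; z],
  y \in [set w; x; y; z] & z \in [set w; x; y; z]].
Proof. by rewrite !inE !eqxx !orbT. Qed.

Let abc_neq m : m \in [:: a; b; c] -> m != d /\ m != e.
Proof.
have := U5; rewrite /= !inE !negb_or -!andbA.
by move=> /and5P[ab ac ad ae] /and5P[bc bd be cd] /and3P[ce de _] /or3P[]/eqP->.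
Qed.

Let adj_new_new w x y z v : uniq [:: w; x; y; z] -> uniq [:: w; x; y; v] ->
  z != v -> [set w; x; y; z] \in K' -> [set w; x; y; v] \in K' ->
  newtet [set w; x; y; z] -> newtet [set w; x; y; v] ->
  pachner23_orientation o a b c d e w x y v =
    ~~ pachner23_orientation o a b c d e w x y z.
Proof.
move=> U1 U2 zv; rewrite !orientationE /=.
set T1 := [set w; x; y; z]; set T2 := [set w; x; y; v] => T1K T2K n1 n2.
have c1 := card4 U1; have c2 := card4 U2.
have [m1 m1T H1] := newP c1 T1K n1; have [m2 m2T H2] := newP c2 T2K n2.
have [U1' E1] := rT c1 T1K n1 U1 erefl.
have [wT1 xT1 yT1 zT1] := memT w x y z; have [wT2 xT2 yT2 vT2] := memT w x y v.
have vN : v \notin T1.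
  move: U2 zv; rewrite /= !inE !negb_or !andbT => /and3P[/and3P[_ _ wv] /andP[_ xv] yv].
  by rewrite !(eq_sym v) wv xv yv => ->.
have zN : z \notin T2.
  move: U1 zv; rewrite /= !inE !negb_or !andbT => /and3P[/and3P[_ _ wv] /andP[_ xv] yv].
  by rewrite !(eq_sym z) wv xv yv eq_sym => ->.
have vm : missing T1 = v.
  by move: vN vT2; rewrite H1 H2 => + /andP[V5 _]; rewrite V5 negbK => /eqP.
have zm : missing T2 = z.
  by move: zN zT1; rewrite H1 H2 => + /andP[V5 _]; rewrite V5 negbK => /eqP.
have [_ ve] := abc_neq m1; have [_ ze] := abc_neq m2.
rewrite vm in ve; rewrite zm in ze.
rewrite n1 n2; move: U1' E1; rewrite /r vm zm (negbTE ve) (negbTE ze).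
have /andP[_] := n1; rewrite !inE -!orbA => eT U' E.
have [F1 F2 F3] := swaps U' (eq_ind_r (fun S => S \in K) abcdK E).
move: U1; rewrite /= !inE !negb_or !andbT => /and3P[/and3P[wx wy _] /andP[xy _] _].
case/or4P: eT => /eqP eE; move: F1 F2 F3; rewrite -?eE ?eqxx.
- by subst e; rewrite !(eq_sym _ w) (negbTE wx) (negbTE wy).
- by subst e; rewrite !(eq_sym _ x) (eq_sym x w) (negbTE wx) (negbTE xy).
- by subst e; rewrite (negbTE wy) (negbTE xy).
- by rewrite eE eqxx in ze.
Qed.

Let adj_new_old w x y z v : uniq [:: w; x; y; z] -> uniq [:: w; x; y; v] ->
  z != v -> [set w; x; y; z] \in K' -> [set w; x; y; v] \in K' ->
  newtet [set w; x; y; z] -> ~~ newtet [set w; x; y; v] ->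
  pachner23_orientation o a b c d e w x y v =
    ~~ pachner23_orientation o a b c d e w x y z.
Proof.
have [alt adj] := o_consistent.
move=> U1 U2 zv; rewrite !orientationE /=.
set T1 := [set w; x; y; z]; set T2 := [set w; x; y; v] => T1K T2K n1 n2.
have c1 := card4 U1; have c2 := card4 U2.
have [T2old T2d T2e] := oldP c2 T2K n2.
have [mabc mT1 H1] := newP c1 T1K n1.
have [U1' E1] := rT c1 T1K n1 U1 erefl.
have [wT1 xT1 yT1 zT1] := memT w x y z.
have [md me] := abc_neq mabc.
rewrite n1 (negbTE n2); move: U1' E1 mT1 mabc md me H1; rewrite /r.
move: (missing T1) => m U' E mT1 mabc md me H1.
have zde : (z == d) || (z == e).
  move: n1 n2; rewrite /newtet !inE -!orbA => /andP[].
  case: (eqVneq z d) => [//|zd]; case: (eqVneq z e) => [|ze]; first by rewrite orbT.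
  rewrite !orbF.
  by move=> /or3P[]-> /or3P[]->; rewrite ?orbT.
move: (mT1); rewrite !inE -!orbA !negb_or => /and4P[mw mx my mz].
move: (U1); rewrite /= !inE !negb_or !andbT.
move=> /and3P[/and3P[wx wy wz] /andP[xy xz] yz].
move: (U2); rewrite /= !inE !negb_or !andbT.
move=> /and3P[/and3P[_ _ wv] /andP[_ xv] yv].
have five t : t \in T1 -> t != z -> t \in abcde /\ t != z.
  by rewrite H1 => /andP[].
have m5 : m \in abcde by move: mabc; rewrite !inE => /or3P[]->; rewrite ?orbT.
have U3 : uniq [:: w; x; y; m].
  by rewrite /= !inE !negb_or wx wy xy !(eq_sym _ m) mw mx my.
pose T0 := if z == e then [set a; b; c; d] else [set a; b; c; e].
have T0K : T0 \in K by rewrite /T0; case: ifP.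
have T0P t : t \in abcde -> t != z -> t \in T0.
  rewrite /T0; case/orP: zde => /eqP->.
    have de : d != e by move: U5; rewrite /= !inE !negb_or -!andbA => /and5P[_ _ _ _ /and5P[_ _ _ _ /and3P[]]].
    rewrite (negbTE de) !inE -!orbA => H td; move: H; rewrite (negbTE td) /=.
    by case/or4P=> ->; rewrite ?orbT.
  rewrite eqxx !inE -!orbA => H te; move: H; rewrite (negbTE te) orbF.
  by case/or4P=> ->; rewrite ?orbT.
have T04 : #|T0| = 4 by rewrite /T0; case: ifP => _; apply: card4.
have in0 t : t \in T1 -> t != z -> t \in T0.
  by move=> /five H /H[]; apply: T0P.
have E3 : [set w; x; y; m] = T0 by apply: set_eq4 => //; first [exact: in0 | exact: T0P].
have vm : v != m.
  apply: contraNneq T2d => vm; apply: contraTT T2e => T2d.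
  rewrite negbK /T2 vm E3 /T0; move: T2d; rewrite /T2 vm E3 /T0.
  by case: ifP; rewrite eqxx.
have A : o w x y v = ~~ o w x y m.
  apply: adj; rewrite ?E3 //.
  rewrite /= !inE !negb_or wx wy xy !(eq_sym _ m) mw mx my wv xv yv.
  by rewrite (eq_sym m) vm.
rewrite A; congr (~~ _).
case/orP: zde => /eqP zE; last first.
  by rewrite -zE eqxx (negbTE wz) (negbTE xz) (negbTE yz).
have ze : z != e.
  by rewrite zE; move: U5; rewrite /= !inE !negb_or -!andbA => /and5P[_ _ _ _ /and5P[_ _ _ _ /and3P[]]].
move: U' E; rewrite (negbTE ze) => U' E.
have eT : e \in T1 by case/andP: n1.
have ET : T0 = [set a; b; c; e] by rewrite /T0 (negbTE ze).
have inK : [set w; x; y; m] \in K by rewrite E3.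
have [F1 F2 F3] := swaps U3 inK.
have PU s : perm_eq s [:: m; w; x; y; z] -> uniq s.
  by move=> /perm_uniq ->; rewrite /= !inE !negb_or mw mx my mz wx wy wz xy xz yz.
have G : good [:: w; x; y; m] by rewrite good4 U3 inK.
have P s : perm_eq s [:: w; x; y; m] -> good s by move/good_perm; apply.
have X1 : [set m; x; y; w] \in K.
  suff: good [:: m; x; y; w] by rewrite good4 => /andP[].
  by apply/P/permP => q /=; case: (q w) (q x) (q y) (q m) => [] [] [] [].
have X2 : [set w; m; y; x] \in K.
  suff: good [:: w; m; y; x] by rewrite good4 => /andP[].
  by apply/P/permP => q /=; case: (q w) (q x) (q y) (q m) => [] [] [] [].
have X3 : [set w; x; m; y] \in K.
  suff: good [:: w; x; m; y] by rewrite good4 => /andP[].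
  by apply/P/permP => q /=; case: (q w) (q x) (q y) (q m) => [] [] [] [].
move: eT; rewrite !inE -!orbA => /or4P[] /eqP eE.
- move: E; rewrite eE eqxx !(eq_sym _ w) (negbTE wx) (negbTE wy) => E.
  apply: negb_inj; rewrite -F1; apply: adj; rewrite ?E //.
    by apply/PU/permP => q /=; case: (q w) (q x) (q y) (q m) (q z) => [] [] [] [] [].
- move: E; rewrite eE eqxx !(eq_sym _ x) (eq_sym x w) (negbTE wx) (negbTE xy) => E.
  apply: negb_inj; rewrite -F2; apply: adj; rewrite ?E //.
    by apply/PU/permP => q /=; case: (q w) (q x) (q y) (q m) (q z) => [] [] [] [] [].
- move: E; rewrite eE eqxx (negbTE wy) (negbTE xy) => E.
  apply: negb_inj; rewrite -F3; apply: adj; rewrite ?E //.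
    by apply/PU/permP => q /=; case: (q w) (q x) (q y) (q m) (q z) => [] [] [] [] [].
- by rewrite eE eqxx in ze.
Qed.

Lemma pachner23_orientation_consistent :
  consistent_orientation K' (pachner23_orientation o a b c d e).
Proof.
have [alt adj] := o_consistent.
split=> [w x y z U TK'|w x y z v U].
  have E1 : [set x; w; y; z] = [set w; x; y; z] by rewrite (setUC [set x]).
  have E2 : [set w; y; x; z] = [set w; x; y; z] by rewrite (setUAC [set w]).
  have E3 : [set w; x; z; y] = [set w; x; y; z] by rewrite setUAC.
  rewrite !orientationE /= E1 E2 E3.
  have T4 := card4 U; case: ifP => nT.
    have [UU EE] := rT T4 TK' nT U erefl.
    by apply: alt; rewrite ?EE.
  by have [? _ _] := oldP T4 TK' (negbT nT); apply: alt.
move=> T1K T2K.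
have U1 : uniq [:: w; x; y; z] by apply: (@take_uniq _ _ 4 U).
have U2 : uniq [:: w; x; y; v].
  apply: subseq_uniq U.
  by apply: (@cat_subseq _ [:: w; x; y] [:: v] [:: w; x; y] [:: z; v]);
    rewrite ?subseq_refl // subseq_cons.
have zv : z != v by move: U; rewrite /= !inE => /and5P[].
have [n1|n1] := boolP (newtet [set w; x; y; z]);
  have [n2|n2] := boolP (newtet [set w; x; y; v]).
- exact: adj_new_new.
- exact: adj_new_old.
- by rewrite (adj_new_old U2 U1) ?negbK // eq_sym.
- have [K1 _ _] := oldP (card4 U1) T1K n1.
  have [K2 _ _] := oldP (card4 U2) T2K n2.
  by rewrite !orientationE /= (negbTE n1) (negbTE n2); apply: adj.
Qed.
End MoveOrientation.

Section LengthFormulas.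
Context {R : realType} {V : finType}.
Implicit Types (p : V -> 'rV[R]_3) (l : {set V} -> R).

Lemma enum_set2 (u v : V) : u != v ->
  enum [set u; v] = [:: u; v] \/ enum [set u; v] = [:: v; u].
Proof.
move=> uv.
have u2 : uniq [:: u; v] by rewrite /= inE uv.
have P : perm_eq (enum [set u; v]) [:: u; v].
  by apply: uniq_perm; rewrite ?enum_uniq // => x; rewrite mem_enum !inE.
have := perm_size P; have := perm_mem P; have := enum_uniq [set u; v].
case: (enum _) => [|x [|y []]] //= /andP[]; rewrite inE => xy _ M _.
have := M x; have := M y; rewrite !inE !eqxx orbT /=.
move=> /esym/orP[]/eqP Ey /esym/orP[]/eqP Ex; subst x y.
- by rewrite eqxx in xy.
- by right.
- by left.
- by rewrite eqxx in xy.
Qed.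

Lemma dotC (x y : 'rV[R]_3) : dot x y = dot y x.
Proof. by apply: eq_bigr => i _; rewrite mulrC. Qed.

Lemma dotDl (x y z : 'rV[R]_3) : dot (x + y) z = dot x z + dot y z.
Proof. by rewrite -big_split; apply: eq_bigr => i _; rewrite mxE mulrDl. Qed.

Lemma dotZl a (x z : 'rV[R]_3) : dot (a *: x) z = a * dot x z.
Proof. by rewrite mulr_sumr; apply: eq_bigr => i _; rewrite mxE mulrA. Qed.

Lemma dotBl (x y z : 'rV[R]_3) : dot (x - y) z = dot x z - dot y z.
Proof. by rewrite -scaleN1r dotDl dotZl mulN1r. Qed.

Lemma dotBr (x y z : 'rV[R]_3) : dot z (x - y) = dot z x - dot z y.
Proof. by rewrite dotC dotBl !(dotC z). Qed.

Lemma dotZr a (x z : 'rV[R]_3) : dot z (a *: x) = a * dot z x.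
Proof. by rewrite dotC dotZl dotC. Qed.

Lemma dot_ge0 (x : 'rV[R]_3) : 0 <= dot x x.
Proof. by apply: sumr_ge0 => i _; rewrite -expr2 sqr_ge0. Qed.

Lemma edistC (x y : 'rV[R]_3) : edist x y = edist y x.
Proof. by rewrite /edist !(dotBl, dotBr) (dotC y x); congr Num.sqrt; ring. Qed.

Lemma edge_lengthE p (u v : V) : u != v ->
  edge_length p [set u; v] = edist (p u) (p v).
Proof.
by move=> /enum_set2[] E; rewrite /edge_length E // edistC.
Qed.

Lemma edge_length_sqr p (u v : V) : u != v ->
  edge_length p [set u; v] ^+ 2 = dot (p v - p u) (p v - p u).
Proof.
by move=> uv; rewrite edge_lengthE // edistC sqr_sqrtr // dot_ge0.
Qed.

Definition vec_angle (x y : 'rV[R]_3) : R :=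
  acos (dot x y / (Num.sqrt (dot x x) * Num.sqrt (dot y y))).

Definition orthogonal_part (h x : 'rV[R]_3) : 'rV[R]_3 :=
  x - (dot h x / dot h h) *: h.

Lemma len_dotE p (u x y : V) : uniq [:: u; x; y] ->
  len_dot (edge_length p) u x y = dot (p x - p u) (p y - p u).
Proof.
rewrite /= !inE negb_or andbT => /andP[/andP[ux uy] xy].
rewrite /len_dot !edge_length_sqr // !(dotBl, dotBr).
by rewrite (dotC (p y) (p x)) (dotC (p u) (p x)) (dotC (p u) (p y)); field.
Qed.

Lemma dihedral_edge_length p (u v x y : V) :
    uniq [:: u; v; x; y] -> p u != p v ->
  dihedral (edge_length p) u v x y =
  vec_angle (orthogonal_part (p v - p u) (p x - p u))
            (orthogonal_part (p v - p u) (p y - p u)).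
Proof.
rewrite /= !inE !negb_or andbT => /andP[/and3P[uv ux uy] /andP[/andP[vx vy] xy]].
move=> puv; rewrite /dihedral !len_dotE ?edge_length_sqr //=;
  try by rewrite !inE negb_or ?uv ?ux ?uy ?vx ?vy ?xy.
set h := p v - p u; set X := p x - p u; set Y := p y - p u.
have h0 : 0 < dot h h.
  rewrite lt_def dot_ge0 andbT; apply: contraNneq puv => hh0.
  rewrite eq_sym -subr_eq0 -/h; apply/eqP/rowP => i; rewrite [RHS]mxE.
  move/eqP: hh0; rewrite psumr_eq0 => [/allP/(_ i (mem_index_enum _))|k _].
    by rewrite /= mulf_eq0 orbb => /eqP.
  by rewrite -expr2 sqr_ge0.
have hn0 := lt0r_neq0 h0.
have E Z W : dot h h * dot Z W - dot h Z * dot h W =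
    dot h h * dot (orthogonal_part h Z) (orthogonal_part h W).
  rewrite /orthogonal_part; move: (h) hn0 => k k0.
  by rewrite !(dotBl, dotBr, dotZl, dotZr) (dotC Z k); field.
rewrite !(expr2 (dot h _)) !E !sqrtrM ?(ltW h0) // /vec_angle; congr acos.
set a := Num.sqrt (dot _ (orthogonal_part h X)).
set b := Num.sqrt (dot _ (orthogonal_part h Y)).
have -> : Num.sqrt (dot h h) * a * (Num.sqrt (dot h h) * b) =
    dot h h * (a * b).
  by rewrite -{3}(sqr_sqrtr (ltW h0)); ring.
by rewrite -mulf_div divff // mul1r.
Qed.

Lemma dihedral_sym l (u v x y : V) :
  dihedral l u v x y = dihedral l v u x y /\
  dihedral l u v x y = dihedral l u v y x.
Proof.
split; rewrite /dihedral /len_dot ?(setUC [set v] [set u]).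
  by congr (acos (_ / (Num.sqrt _ * Num.sqrt _))); field.
rewrite (setUC [set y] [set x]) [X in _ / X]mulrC.
by congr (acos (_ / _)); field.
Qed.

Lemma dihedral_atE l (u v x y : V) : uniq [:: u; v; x; y] ->
  dihedral_at l [set u; v] [set u; v; x; y] = dihedral l u v x y.
Proof.
rewrite /= !inE !negb_or andbT => /andP[/and3P[uv ux uy] /andP[/andP[vx vy] xy]].
have -> : dihedral_at l [set u; v] [set u; v; x; y] =
    if (enum [set u; v], enum [set x; y]) is ([:: u'; v'], [:: x'; y'])
    then dihedral l u' v' x' y' else 0.
  rewrite /dihedral_at; suff -> : [set u; v; x; y] :\: [set u; v] = [set x; y].
    by case: (enum _) => [|? [|? []]] //; case: (enum _) => [|? [|? []]].
  apply/setP => z; rewrite !inE.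
  case: (eqVneq z u) => [->|_] /=; first by rewrite (negbTE ux) (negbTE uy).
  case: (eqVneq z v) => [->|_] //=; by rewrite (negbTE vx) (negbTE vy).
have [S1 S2] := dihedral_sym l u v x y.
have [_ S3] := dihedral_sym l v u x y.
by case: (enum_set2 uv) => ->; case: (enum_set2 xy) => ->; rewrite // ?S1.
Qed.

End LengthFormulas.

(* Main.v *)
Require Import Defs.
From mathcomp Require Import all_boot all_order all_algebra.
From mathcomp Require Import all_classical all_reals all_analysis.
From mathcomp Require perm mpoly.
From mathcomp Require Import finset ring lra.
Set Implicit Arguments.
Unset Strict Implicit.
Unset Printing Implicit Defensive.
Import Order.TTheory GRing.Theory Num.Theory numFieldNormedType.Exports.
Import (canonicals) mpoly.
Local Open Scope ring_scope.

(** Nothing but the five vertices of the move matters.  Let [alpha] be the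
    affine dependency of their images: [\sum_i alpha_i = 0] and
    [\sum_i alpha_i * p_i = 0], where [alpha_i] is, up to sign, [6V] of the
    tetrahedron opposite to [i] ([dependency]).

    The two old tetrahedra with reversed orientation and the three new ones form
    the oriented boundary of a 4-simplex, and the sign with which the angles of
    the tetrahedron opposite to [i] enter the difference between the new and the
    old defect angles is that of [alpha_i], up to a common factor
    ([move_orientation_signs]).  In space, the signed angles around an edge sum
    to zero modulo [2 pi].  Therefore the derivative of this sum, as a covector
    on the lengths, is a multiple of the derivative of the quadratic form
    [\sum_(i, j) alpha_i * alpha_j * l_ij ^+ 2], up to a factor the only covector
    that vanishes on all changes of the lengths realizable in space.  This
    proportionality is checked by a computation with scalar products
    ([angle_rate_star], [boundary_rateE]).

    So the new matrix is the old one, bordered by zeros at the new edge, plus a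
    matrix of rank one.  Its column at the new edge is the column of the rank one
    matrix, so column operations give [det A_new = A_new(de, de) * det A] for the
    submatrices on the two subsets of edges ([det_principal_add],
    [det_submatrix_move]).  The factor [A_new(de, de)] is, up to sign,
    [l_de ^+ 2 * alpha_d * alpha_e / (alpha_a * alpha_b * alpha_c)], and this is
    what compensates the change of the products of the lengths and the volumes.

    The argument needs only that the new tetrahedra are nondegenerate as well,
    which is the nonvanishing of a polynomial in the coordinates. *)

(** * Derivatives of elementary functions *)

Section AngleCalculus.
Context {R : realType}.
Implicit Types (f g : R -> R) (t : R).

Lemma is_derive_mul f g t df dg :
  is_derive t 1 f df -> is_derive t 1 g dg ->
  is_derive t 1 (fun s => f s * g s) (df * g t + f t * dg).
Proof.
move=> Df Dg; have H := is_deriveM Df Dg.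
by apply: is_derive_eq H _; rewrite -![_ *: _]/(_ * _); ring.
Qed.

Lemma is_derive_sub f g t df dg :
  is_derive t 1 f df -> is_derive t 1 g dg ->
  is_derive t 1 (fun s => f s - g s) (df - dg).
Proof. by move=> Df Dg; exact: is_deriveB. Qed.

Lemma is_derive_add f g t df dg :
  is_derive t 1 f df -> is_derive t 1 g dg ->
  is_derive t 1 (fun s => f s + g s) (df + dg).
Proof. by move=> Df Dg; exact: is_deriveD. Qed.

Lemma is_derive_sqr f t df :
  is_derive t 1 f df -> is_derive t 1 (fun s => f s ^+ 2) (2 * f t * df).
Proof.
move=> Df; have H := is_derive_mul Df Df.
by apply: is_derive_eq H _; ring.
Qed.

Lemma is_derive_sqrtr f t df : 0 < f t ->
  is_derive t 1 f df ->
  is_derive t 1 (fun s => Num.sqrt (f s)) (df / (2 * Num.sqrt (f t))).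
Proof.
move=> f0 Df; have H := @is_derive1_comp _ _ f t _ _ (is_derive1_sqrt f0) Df.
by apply: is_derive_eq H _; rewrite mulrC.
Qed.

Lemma is_derive_acos_quotient (P Q1 Q2 : R -> R) t dP dQ1 dQ2 :
  is_derive t 1 P dP -> is_derive t 1 Q1 dQ1 -> is_derive t 1 Q2 dQ2 ->
  0 < Q1 t -> 0 < Q2 t -> P t ^+ 2 < Q1 t * Q2 t ->
  is_derive t 1 (fun s => acos (P s / (Num.sqrt (Q1 s) * Num.sqrt (Q2 s))))
    (- (dP - P t / 2 * (dQ1 / Q1 t + dQ2 / Q2 t)) /
       Num.sqrt (Q1 t * Q2 t - P t ^+ 2)).
Proof.
move=> DP DQ1 DQ2 Q1gt0 Q2gt0 PQ.
have D1 := is_derive_sqrtr Q1gt0 DQ1.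
have D2 := is_derive_sqrtr Q2gt0 DQ2.
have DS := is_derive_mul D1 D2.
have r1 : 0 < Num.sqrt (Q1 t) by rewrite sqrtr_gt0.
have r2 : 0 < Num.sqrt (Q2 t) by rewrite sqrtr_gt0.
have S0 : Num.sqrt (Q1 t) * Num.sqrt (Q2 t) != 0 by rewrite mulf_neq0 ?gt_eqF.
have DI := @is_deriveV _ _ t _ 1 S0 DS.
have DC := is_derive_mul DP DI.
set c : R -> R := fun s => P s / (Num.sqrt (Q1 s) * Num.sqrt (Q2 s)).
have e1 : Num.sqrt (Q1 t) ^+ 2 = Q1 t by rewrite sqr_sqrtr // ltW.
have e2 : Num.sqrt (Q2 t) ^+ 2 = Q2 t by rewrite sqr_sqrtr // ltW.
have c2 : 1 - c t ^+ 2 = (Q1 t * Q2 t - P t ^+ 2) / (Q1 t * Q2 t).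
  rewrite /c expr_div_n exprMn e1 e2; field.
  by rewrite !gt_eqF.
have q0 : 0 < Q1 t * Q2 t by rewrite mulr_gt0.
have c2gt : 0 < 1 - c t ^+ 2 by rewrite c2 divr_gt0 // subr_gt0.
have cI : -1 < c t < 1 by rewrite -ltr_norml -sqrtr_sqr -sqrtr1 ltr_sqrt // -subr_gt0.
have := @is_derive1_comp _ _ c t _ _ (is_derive1_acos cI) DC.
move=> H; apply: is_derive_eq H _.
rewrite c2 sqrtrM ?subr_ge0 ?(ltW PQ) // sqrtrV ?(ltW q0) // sqrtrM ?(ltW Q1gt0) //.
rewrite -![_ *: _]/(_ * _).
have w0 : 0 < Num.sqrt (Q1 t * Q2 t - P t ^+ 2) by rewrite sqrtr_gt0 subr_gt0.
move: (Num.sqrt (_ - _)) w0 => w w0.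
move: (Num.sqrt (Q1 t)) (Num.sqrt (Q2 t)) e1 e2 r1 r2 => s1 s2 <- <- s1p s2p.
by field; rewrite !gt_eqF.
Qed.

End AngleCalculus.

(** * Vectors in space *)

Section Vectors.
Context {R : realType}.
Implicit Types x y z w v : 'rV[R]_3.

(** The triple product, i.e. the signed volume of the parallelepiped spanned
    by [x], [y] and [z]. *)
Definition triple x y z : R := \det (\matrix_(i < 3) [:: x; y; z]`_i).

Let i0 : 'I_3 := ord0.
Let i1 : 'I_3 := lift ord0 ord0.
Let i2 : 'I_3 := lift ord0 (lift ord0 ord0).

Lemma dotE x y : dot x y = x 0 i0 * y 0 i0 + x 0 i1 * y 0 i1 + x 0 i2 * y 0 i2.
Proof. by rewrite /dot !big_ord_recl big_ord0 addr0 addrA. Qed.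

Lemma tripleE x y z : triple x y z =
  x 0 i0 * (y 0 i1 * z 0 i2 - y 0 i2 * z 0 i1)
  - x 0 i1 * (y 0 i0 * z 0 i2 - y 0 i2 * z 0 i0)
  + x 0 i2 * (y 0 i0 * z 0 i1 - y 0 i1 * z 0 i0).
Proof.
have det22 (A : 'M[R]_2) : \det A =
    A ord0 ord0 * A (lift ord0 ord0) (lift ord0 ord0)
    - A ord0 (lift ord0 ord0) * A (lift ord0 ord0) ord0.
  rewrite (expand_det_row _ ord0) !big_ord_recl big_ord0 /cofactor !det_mx11.
  rewrite !mxE /= addr0 expr0 expr1 mul1r mulN1r mulrN.
  by congr (_ * A _ _ - _ * A _ _); apply/val_inj.
rewrite /triple (expand_det_row _ ord0) !big_ord_recl big_ord0 /cofactor.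
rewrite !det22 !mxE /=.
have -> : lift (lift ord0 ord0) ord0 = i0 by apply/val_inj.
have -> : lift (lift ord0 ord0) (lift ord0 ord0) = i2 by apply/val_inj.
have -> : lift i2 ord0 = i0 by apply/val_inj.
have -> : lift i2 (lift ord0 ord0) = i1 by apply/val_inj.
rewrite -/i0 -/i1 -/i2 /bump /=; ring.
Qed.

(** The volume spanned by [v], [x] and [y] is the length of [v] times the area
    spanned by the components of [x] and [y] orthogonal to [v].  The left side
    is the Gram determinant of these components times [dot v v ^+ 2]. *)
Lemma triple_sqr v x y :
  (dot v v * dot x x - dot v x ^+ 2) * (dot v v * dot y y - dot v y ^+ 2)
  - (dot v v * dot x y - dot v x * dot v y) ^+ 2 = dot v v * triple v x y ^+ 2.
Proof. rewrite !dotE tripleE; ring. Qed.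

Lemma triple_dependent v x y z (cv cx cy cz : R) :
  cv *: v + cx *: x + cy *: y + cz *: z = 0 ->
  cy * triple v x y = - (cz * triple v x z).
Proof.
move=> dep.
have dep_i i : cy * y 0 i = - (cv * v 0 i + cx * x 0 i + cz * z 0 i).
  by move/rowP/(_ i): dep; rewrite !mxE => dep; lra.
rewrite !tripleE.
transitivity (v 0 i0 * (x 0 i1 * (cy * y 0 i2) - x 0 i2 * (cy * y 0 i1))
  - v 0 i1 * (x 0 i0 * (cy * y 0 i2) - x 0 i2 * (cy * y 0 i0))
  + v 0 i2 * (x 0 i0 * (cy * y 0 i1) - x 0 i1 * (cy * y 0 i0))); first by ring.
rewrite !dep_i; ring.
Qed.

(** Cramer's rule for four vectors in space. *)
Lemma triple_cramer v x y z :
  - triple x y z *: v + triple v y z *: x + triple v z x *: y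
  + triple v x y *: z = 0.
Proof.
apply/rowP => i; rewrite !mxE !tripleE.
have : i \in [:: i0; i1; i2].
  by case: i => [[|[|[|?]]] ?]; rewrite ?inE //=.
by rewrite !inE => /or3P[]/eqP->; ring.
Qed.

Lemma dot_gt0 v : v != 0 -> 0 < dot v v.
Proof.
move=> v0; rewrite lt_def dot_ge0 andbT; apply: contraNneq v0 => vv0.
apply/eqP/rowP => i; rewrite [RHS]mxE.
move/eqP: vv0; rewrite psumr_eq0 => [/allP/(_ i (mem_index_enum _))|k _].
  by rewrite /= mulf_eq0 orbb => /eqP.
by rewrite -expr2 sqr_ge0.
Qed.

End Vectors.

(** * Dihedral angles as functions of lengths *)

Section Angles.
Context {R : realType} {V : finType}.
Implicit Types (p : V -> 'rV[R]_3) (l : {set V} -> R) (k : {set V}).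

(** The scalar product of the vectors [ux] and [uy] in the placement [p]. *)
Definition inner p (u x y : V) : R := dot (p x - p u) (p y - p u).

(** The scalar product of the components of [ux] and [uy] orthogonal to [uv],
    multiplied by the squared length of [uv]. *)
Definition proj_inner p (u v x y : V) : R :=
  inner p u v v * inner p u x y - inner p u v x * inner p u v y.

(** The derivative of [inner] when the squared length of every edge [ij]
    changes at the rate [m i j]. *)
Definition inner_rate (m : V -> V -> R) (u x y : V) : R :=
  (m u x + m u y - m x y) / 2.

(** The derivative of [proj_inner] under the same change of lengths. *)
Definition proj_rate m p (u v x y : V) : R :=
  inner_rate m u v v * inner p u x y + inner p u v v * inner_rate m u x y
  - (inner_rate m u v x * inner p u v y + inner p u v x * inner_rate m u v y).

(** The derivative of the dihedral angle at [uv] of the tetrahedron [uvxy],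
    multiplied by [- l_uv * 6V]. *)
Definition angle_rate m p (u v x y : V) : R :=
  proj_rate m p u v x y - proj_inner p u v x y / 2 *
    (proj_rate m p u v x x / proj_inner p u v x x +
     proj_rate m p u v y y / proj_inner p u v y y).

(** The derivative of the squared length of [ij] with respect to the length of
    [k]; it vanishes for [i = j] because [l] vanishes on singletons. *)
Definition sqlen_rate l k (i j : V) : R :=
  2 * l [set i; j] * ([set i; j] == k)%:R.

Lemma sqlen_rateC l k i j : sqlen_rate l k i j = sqlen_rate l k j i.
Proof. by rewrite /sqlen_rate setUC. Qed.

Lemma sqlen_ratexx p k i : sqlen_rate (edge_length p) k i i = 0.
Proof. by rewrite /sqlen_rate /edge_length setUid enum_set1 mulr0 mul0r. Qed.

Lemma set_lengthK l k : set_length l k (l k) = l.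
Proof. by apply/funext => i; rewrite /set_length; case: eqP => // ->. Qed.

Lemma is_derive_set_length l k (j : {set V}) (t : R) :
  is_derive t 1 (fun s => set_length l k s j) ((j == k)%:R : R).
Proof.
by rewrite /set_length; case: eqP => _; [exact: is_derive_id|exact: is_derive_cst].
Qed.

Lemma is_derive_sqr_length l k (i j : V) :
  is_derive (l k) 1 (fun s => set_length l k s [set i; j] ^+ 2)
    (sqlen_rate l k i j).
Proof.
have H := is_derive_sqr (is_derive_set_length l k [set i; j] (l k)).
by apply: is_derive_eq H _; rewrite set_lengthK.
Qed.

Lemma is_derive_len_dot l k (u x y : V) :
  is_derive (l k) 1 (fun s => len_dot (set_length l k s) u x y)
    (inner_rate (sqlen_rate l k) u x y).
Proof.
have H := is_derive_mul (is_derive_sub (is_derive_add (is_derive_sqr_length l k u x)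
  (is_derive_sqr_length l k u y)) (is_derive_sqr_length l k x y))
  (is_derive_cst (2^-1 : R) (l k) 1).
by apply: is_derive_eq H _; rewrite /inner_rate /cst /= mulr0 addr0.
Qed.

Lemma det4E p a b c d : det4 p a b c d = triple (p b - p a) (p c - p a) (p d - p a).
Proof. by []. Qed.

Lemma det4_neq p u v x y : det4 p u v x y != 0 -> p u != p v.
Proof.
apply: contraNneq => E; rewrite det4E E subrr tripleE !mxE; apply/eqP; ring.
Qed.

Lemma inner_gt0 p u v : p u != p v -> 0 < inner p u v v.
Proof. by move=> uv; rewrite dot_gt0 // subr_eq0 eq_sym. Qed.

Lemma proj_inner_gt0 p u v x y : det4 p u v x y != 0 ->
  [/\ 0 < proj_inner p u v x x, 0 < proj_inner p u v y y &
   proj_inner p u v x y ^+ 2 < proj_inner p u v x x * proj_inner p u v y y].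
Proof.
move=> D0; have h0 := inner_gt0 (det4_neq D0).
have E := triple_sqr (p v - p u) (p x - p u) (p y - p u).
rewrite -det4E in E.
have S : proj_inner p u v x y ^+ 2 < proj_inner p u v x x * proj_inner p u v y y.
  rewrite -subr_gt0 /proj_inner -!expr2 E mulr_gt0 //.
  by rewrite exprn_even_gt0.
suff ge0 z : 0 <= proj_inner p u v z z.
  have P : 0 < proj_inner p u v x x * proj_inner p u v y y.
    by apply: le_lt_trans S; rewrite sqr_ge0.
  by split=> //; rewrite lt_def ge0 andbT; apply: contraTneq P => ->;
    rewrite ?mul0r ?mulr0 ltxx.
rewrite /proj_inner /inner; rewrite !dotE.
move: (p v - p u) (p z - p u) => f g.
move: (f 0 ord0) (f 0 (lift ord0 ord0)) (f 0 (lift ord0 (lift ord0 ord0))).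
move: (g 0 ord0) (g 0 (lift ord0 ord0)) (g 0 (lift ord0 (lift ord0 ord0))).
move=> z0 z1 z2 v0 v1 v2.
have -> : (v0 * v0 + v1 * v1 + v2 * v2) * (z0 * z0 + z1 * z1 + z2 * z2) -
    (v0 * z0 + v1 * z1 + v2 * z2) * (v0 * z0 + v1 * z1 + v2 * z2) =
    (v0 * z1 - v1 * z0) ^+ 2 + (v0 * z2 - v2 * z0) ^+ 2 + (v1 * z2 - v2 * z1) ^+ 2.
  by ring.
by rewrite !addr_ge0 ?sqr_ge0.
Qed.

(** The derivative of a dihedral angle of a nondegenerate tetrahedron with
    respect to an arbitrary length. *)
Lemma is_derive_dihedral p k u v x y :
    uniq [:: u; v; x; y] -> det4 p u v x y != 0 ->
  is_derive (edge_length p k) 1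
    (fun t => dihedral (set_length (edge_length p) k t) u v x y)
    (- angle_rate (sqlen_rate (edge_length p) k) p u v x y /
       (edge_length p [set u; v] * `|det4 p u v x y|)).
Proof.
move=> U D0; have [Qx Qy PQ] := proj_inner_gt0 D0.
move: (U); rewrite /= !inE !negb_or andbT.
move=> /andP[/and3P[uv ux uy] /andP[/andP[vx vy] xy]].
set l := edge_length p; set t := l k.
have lenE i j : i != j -> l [set i; j] ^+ 2 = inner p i j j.
  by move=> ij; rewrite /l edge_length_sqr.
have lE i j w : uniq [:: i; j; w] -> len_dot l i j w = inner p i j w.
  by move=> ijw; rewrite /l len_dotE.
have D i j := is_derive_sqr_length l k i j.
have Dl i j w := is_derive_len_dot l k i j w.
have DP := is_derive_sub (is_derive_mul (D u v) (Dl u x y))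
                         (is_derive_mul (Dl u v x) (Dl u v y)).
have DQ z := is_derive_sub (is_derive_mul (D u v) (D u z))
                           (is_derive_sqr (Dl u v z)).
have e2 : edge_length p [set u; v] = Num.sqrt (inner p u v v).
  by rewrite -lenE // sqrtr_sqr ger0_norm // /l edge_lengthE // sqrtr_ge0.
have vP : l [set u; v] ^+ 2 * len_dot l u x y - len_dot l u v x * len_dot l u v y =
    proj_inner p u v x y.
  by rewrite lenE // !lE //= !inE ?negb_or ?uv ?ux ?uy ?vx ?vy ?xy.
have vQ z : u != z -> v != z ->
    l [set u; v] ^+ 2 * l [set u; z] ^+ 2 - len_dot l u v z ^+ 2 = proj_inner p u v z z.
  by move=> uz vz; rewrite !lenE // lE //= !inE ?negb_or ?uv ?uz ?vz.
have H := @is_derive_acos_quotient _ _ _ _ _ _ _ _ DP (DQ x) (DQ y).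
move: H; rewrite /= !set_lengthK vP !vQ // => /(_ Qx Qy PQ) H.
apply: is_derive_eq H _.
have -> : Num.sqrt (proj_inner p u v x x * proj_inner p u v y y
    - proj_inner p u v x y ^+ 2) = l [set u; v] * `|det4 p u v x y|.
  rewrite /proj_inner -!expr2 triple_sqr -det4E.
  rewrite sqrtrM ?sqrtr_sqr -/(inner p u v v) -?e2 //.
  exact/ltW/inner_gt0/det4_neq/D0.
rewrite !lenE // !lE /= ?inE ?negb_or ?uv ?ux ?uy ?vx ?vy ?xy //.
have rr i j : inner_rate (sqlen_rate l k) i j j = sqlen_rate l k i j.
  by rewrite /inner_rate /l sqlen_ratexx; field.
rewrite /angle_rate /proj_rate !rr.
congr (- _ / _).
by congr (_ - _ * (_ / _ + _ / _)); ring.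
Qed.

(** The angles at [uv] between the half-planes through [x], [y] and [z], taken
    with signs, sum to a multiple of [2 pi] as long as the five points are in
    space.  Accordingly the signed sum of their rates is a multiple of the linear
    form [\sum_(i < j) c_i * c_j * m i j] in the rates [m] of the squared
    lengths, where [c] is the affine dependency of the five points: this form
    vanishes on the rates that come from a motion of the points in space. *)
Lemma angle_rate_star m p u v x y z (cu cv cx cy cz : R) :
    (forall i j, m i j = m j i) -> (forall i, m i i = 0) ->
    cu + cv + cx + cy + cz = 0 ->
    cv *: (p v - p u) + cx *: (p x - p u) + cy *: (p y - p u)
      + cz *: (p z - p u) = 0 ->
    cx != 0 -> cy != 0 -> cz != 0 ->
    proj_inner p u v x x != 0 -> proj_inner p u v y y != 0 ->
    proj_inner p u v z z != 0 ->
  angle_rate m p u v x y / cz + angle_rate m p u v y z / cx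
    + angle_rate m p u v z x / cy =
  - (inner p u v v / (2 * cx * cy * cz)) *
    (cu * cv * m u v + cu * cx * m u x + cu * cy * m u y + cu * cz * m u z +
     cv * cx * m v x + cv * cy * m v y + cv * cz * m v z +
     cx * cy * m x y + cx * cz * m x z + cy * cz * m y z).
Proof.
move=> mC mxx c0 dep cx0 cy0 cz0 Qx0 Qy0 Qz0.
have iC i j : inner p u i j = inner p u j i by rewrite /inner dotC.
have depw w : cv * inner p u w v + cx * inner p u w x + cy * inner p u w y
    + cz * inner p u w z = 0.
  have := congr1 (fun s => dot s (p w - p u)) dep.
  rewrite !dotDl !dotZl -!/(inner p u _ w) !(iC _ w) => ->.
  by rewrite /dot big1 // => i _; rewrite mxE mul0r.
have PC i j : proj_inner p u v i j = proj_inner p u v j i.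
  by rewrite /proj_inner iC; ring.
have depP w : cx * proj_inner p u v w x + cy * proj_inner p u v w y
    + cz * proj_inner p u v w z = 0.
  have E1 := depw w; have E2 := depw v.
  transitivity (inner p u v v * (cv * inner p u w v + cx * inner p u w x
      + cy * inner p u w y + cz * inner p u w z)
    - inner p u w v * (cv * inner p u v v + cx * inner p u v x
      + cy * inner p u v y + cz * inner p u v z)).
    by rewrite /proj_inner (iC w v); ring.
  by rewrite E1 E2 !mulr0 subrr.
(* By depP, the derivatives of the denominators contribute the diagonal terms
   of a quadratic form in the coefficients. *)
have step : angle_rate m p u v x y / cz + angle_rate m p u v y z / cx
    + angle_rate m p u v z x / cy =
    (cx ^+ 2 * proj_rate m p u v x x + cy ^+ 2 * proj_rate m p u v y y
      + cz ^+ 2 * proj_rate m p u v z z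
      + 2 * (cx * cy * proj_rate m p u v x y + cy * cz * proj_rate m p u v y z
        + cz * cx * proj_rate m p u v z x)) / (2 * cx * cy * cz).
  have Ex := depP x; have Ey := depP y; have Ez := depP z.
  rewrite (PC y x) in Ey; rewrite (PC z y) in Ez; rewrite (PC x z) in Ex.
  rewrite /angle_rate.
  have ex : cx = - (cy * proj_inner p u v x y + cz * proj_inner p u v z x)
      / proj_inner p u v x x.
    by apply: (canRL (mulfK Qx0)); lra.
  have ey : cy = - (cx * proj_inner p u v x y + cz * proj_inner p u v y z)
      / proj_inner p u v y y.
    by apply: (canRL (mulfK Qy0)); lra.
  have ez : cz = - (cx * proj_inner p u v z x + cy * proj_inner p u v y z)
      / proj_inner p u v z z.
    by apply: (canRL (mulfK Qz0)); lra.
  move: (proj_rate m p u v) (proj_inner p u v) Qx0 Qy0 Qz0 ex ey ez => dP P.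
  move=> Qx0 Qy0 Qz0 ex ey ez.
  transitivity ((2 * (cx * cy * dP x y + cy * cz * dP y z + cz * cx * dP z x)
     - cx * dP x x * ((cy * P x y + cz * P z x) / P x x)
     - cy * dP y y * ((cx * P x y + cz * P y z) / P y y)
     - cz * dP z z * ((cx * P z x + cy * P y z) / P z z)) / (2 * cx * cy * cz)).
    by field; rewrite ?Qx0 ?Qy0 ?Qz0 ?cx0 ?cy0 ?cz0.
  congr (_ / _).
  have ex' : (cy * P x y + cz * P z x) / P x x = - cx by rewrite [in RHS]ex mulNr opprK.
  have ey' : (cx * P x y + cz * P y z) / P y y = - cy by rewrite [in RHS]ey mulNr opprK.
  have ez' : (cx * P z x + cy * P y z) / P z z = - cz by rewrite [in RHS]ez mulNr opprK.
  by rewrite ex' ey' ez'; ring.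
rewrite step.
set h := inner p u v v.
have A : cx * inner p u v x + cy * inner p u v y + cz * inner p u v z = - (cv * h).
  by have := depw v; rewrite -/h => E; lra.
have G : cx * (cx * inner p u x x + cy * inner p u x y + cz * inner p u x z)
    + cy * (cx * inner p u y x + cy * inner p u y y + cz * inner p u y z)
    + cz * (cx * inner p u z x + cy * inner p u z y + cz * inner p u z z)
    = cv ^+ 2 * h.
  have B w : cx * inner p u w x + cy * inner p u w y + cz * inner p u w z =
      - (cv * inner p u v w).
    by have := depw w; rewrite (iC w v) => E; lra.
  rewrite !B; transitivity (- cv * (cx * inner p u v x + cy * inner p u v y
    + cz * inner p u v z)); first by ring.
  by rewrite A; ring.
have rr i : inner_rate m u i i = m u i by rewrite /inner_rate mxx; field.
rewrite !(iC y x) !(iC z x) !(iC z y) in G.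
transitivity ((m u v * (cv ^+ 2 * h)
    + h * (cx ^+ 2 * m u x + cy ^+ 2 * m u y + cz ^+ 2 * m u z
      + 2 * (cx * cy * inner_rate m u x y + cy * cz * inner_rate m u y z
        + cz * cx * inner_rate m u z x))
    + 2 * (cv * h) * (cx * inner_rate m u v x + cy * inner_rate m u v y
      + cz * inner_rate m u v z)) / (2 * cx * cy * cz)).
  congr (_ / _); rewrite -G -[cv * h]opprK -A /proj_rate -/h !rr (iC z x); ring.
have -> : cu = - (cv + cx + cy + cz) by lra.
by rewrite /inner_rate (mC z x); field; rewrite cx0 cy0 cz0.
Qed.

End Angles.

(** * Simplices as sets of vertices *)

Section SwapInvariance.
Variables (T : eqType) (A : Type) (G : seq T -> A) (s0 : seq T).
Hypothesis swapG : forall r x y t, perm_eq (r ++ [:: x, y & t]) s0 ->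
  G (r ++ [:: x, y & t]) = G (r ++ [:: y, x & t]).

(** A function on the orderings of a set is constant as soon as it is invariant
    under adjacent transpositions. *)
Lemma swap_invariant s t : perm_eq s s0 -> perm_eq s t -> G s = G t.
Proof.
have bubble x t1 t2 : forall r, perm_eq (r ++ x :: t1 ++ t2) s0 ->
    G (r ++ x :: t1 ++ t2) = G (r ++ t1 ++ x :: t2).
  elim: t1 => [//|y t1 IH] r E; rewrite cat_cons swapG //.
  rewrite cat_cons -[LHS]/(G (r ++ y :: (x :: t1 ++ t2))) -!(cat_rcons y).
  apply: IH; apply: perm_trans E; rewrite cat_rcons perm_cat2l.
  by apply/permP => q /=; rewrite addnCA.
suff H r : perm_eq (r ++ s) s0 -> perm_eq s t -> G (r ++ s) = G (r ++ t).
  exact: (H [::]).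
elim: s r t => [|x s IH] r t rs0 st.
  by have := perm_size st; case: t {st}.
have xt : x \in t by rewrite -(perm_mem st) mem_head.
case/splitPr: xt st => t1 t2 st.
have st' : perm_eq s (t1 ++ t2).
  rewrite -(perm_cons x); apply: perm_trans st _.
  by rewrite perm_catC /= perm_cons perm_catC.
rewrite -bubble; last first.
  apply: perm_trans rs0; rewrite perm_cat2l perm_cons perm_sym //.
by rewrite -!cat_rcons; apply: IH => //; rewrite cat_rcons.
Qed.
End SwapInvariance.

Section Simplices.
Context {R : realType} {V : finType}.
Implicit Types (p : V -> 'rV[R]_3) (o : V -> V -> V -> V -> bool)
  (u v w x y z : V) (T : {set V}).

Lemma set2_eq u v x y :
  ([set u; v] == [set x; y]) = (u == x) && (v == y) || (u == y) && (v == x).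
Proof.
rewrite eqEsubset !subUset !sub1set !inE !(eq_sym x) !(eq_sym y).
by case: (u == x) (v == x) (u == y) (v == y) => [] [] [] [].
Qed.

Lemma perm_enum_set4 w x y z : uniq [:: w; x; y; z] ->
  perm_eq [:: w; x; y; z] (enum [set w; x; y; z]).
Proof.
move=> U; apply: uniq_perm; rewrite ?enum_uniq // => v.
by rewrite mem_enum !inE !orbA.
Qed.

Lemma card_set4 w x y z : uniq [:: w; x; y; z] -> #|[set w; x; y; z]| = 4%N.
Proof. by move=> U; rewrite cardE -(perm_size (perm_enum_set4 U)). Qed.

(** A function of ordered quadruples extended by [0] to all sequences. *)
Definition on_quadruple (F : V -> V -> V -> V -> R) (s : seq V) : R :=
  if s is [:: a; b; c; d] then F a b c d else 0.

Lemma on_quadruple_enum (F : V -> V -> V -> V -> R) w x y z :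
    uniq [:: w; x; y; z] ->
    (forall a b c d, uniq [:: a; b; c; d] ->
       [set a; b; c; d] = [set w; x; y; z] ->
       [/\ F b a c d = F a b c d, F a c b d = F a b c d & F a b d c = F a b c d]) ->
  on_quadruple F (enum [set w; x; y; z]) = F w x y z.
Proof.
move=> U FP; have P := perm_enum_set4 U.
rewrite -[RHS]/(on_quadruple F [:: w; x; y; z]).
apply/esym/(@swap_invariant _ _ _ [:: w; x; y; z]) => //.
move=> r a b t; rewrite perm_sym => E.
have := perm_size E; rewrite size_cat /= !addnS => sz; have Uq := perm_uniq E.
have SE : [set v in r ++ [:: a, b & t]] = [set w; x; y; z].
  by apply/setP => v; rewrite !inE -(perm_mem E) !inE !orbA.
rewrite U in Uq; move: Uq SE sz.
case: r E => [|c [|d [|? ?]]] _; case: t => [|f [|g [|? ?]]] //= Uq SE _;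
  case: (FP _ _ _ _ (esym Uq)) => [|//]; rewrite -SE; apply/setP => v;
  by rewrite !inE !orbA.
Qed.

Lemma det4_swap p a b c d :
  [/\ det4 p b a c d = - det4 p a b c d, det4 p a c b d = - det4 p a b c d &
      det4 p a b d c = - det4 p a b c d].
Proof. by split; rewrite !det4E !tripleE !mxE; ring. Qed.

Lemma volumeE p w x y z : uniq [:: w; x; y; z] ->
  volume p [set w; x; y; z] = `|det4 p w x y z| / 6.
Proof.
move=> U.
rewrite -(on_quadruple_enum (F := fun a b c d => `|det4 p a b c d| / 6) U) //.
by move=> a b c d _ _; have [-> -> ->] := det4_swap p a b c d; rewrite !normrN.
Qed.

Lemma volume_gt0 p w x y z : uniq [:: w; x; y; z] ->
  (0 < volume p [set w; x; y; z]) = (det4 p w x y z != 0).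
Proof. by move=> U; rewrite volumeE // pmulr_lgt0 ?normr_gt0 // invr_gt0. Qed.

Lemma orientation_signE K o p w x y z : consistent_orientation K o ->
    uniq [:: w; x; y; z] -> [set w; x; y; z] \in K ->
  orientation_sign o p [set w; x; y; z] =
  (-1) ^+ (~~ o w x y z) * Num.sg (det4 p w x y z).
Proof.
move=> [alt _] U inK.
rewrite -(on_quadruple_enum
  (F := fun a b c d => (-1) ^+ (~~ o a b c d) * Num.sg (det4 p a b c d)) U) //.
move=> a b c d Uabcd E; rewrite -E in inK.
have [-> -> ->] := alt _ _ _ _ Uabcd inK; have [-> -> ->] := det4_swap p a b c d.
by rewrite !sgrN; case: (o a b c d); rewrite /= !(expr0, expr1); split; ring.
Qed.

Lemma edge_tetrahedronP (j T : {set V}) : #|j| = 2%N -> #|T| = 4%N -> j \subset T ->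
  exists u v x y, [/\ uniq [:: u; v; x; y], j = [set u; v] & T = [set u; v; x; y]].
Proof.
move=> /eqP/cards2P[u [v [uv jE]]] T4 jT.
have : #|T :\: j| = 2%N.
  by have := cardsID j T; rewrite (setIidPr jT) jE cards2 uv T4 => -[].
move=> /eqP/cards2P[x [y [xy TE]]].
have TuE : T = [set u; v; x; y].
  rewrite -(setID T j) (setIidPr jT) TE jE.
  by apply/setP => i; rewrite !inE !orbA.
exists u, v, x, y; split=> //.
have dis i : i \in [set x; y] -> i \notin [set u; v] by rewrite -TE -jE inE => /andP[].
have := dis x; have := dis y; rewrite !inE !eqxx orbT !negb_or.
move=> /(_ isT)/andP[yu yv] /(_ isT)/andP[xu xv].
by rewrite /= !inE !negb_or uv !(eq_sym u) !(eq_sym v) yu yv xu xv xy.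
Qed.

End Simplices.

(** * Derivatives of defect angles *)

Section DefectDerivative.
Context {R : realType} {V : finType}.
Implicit Types (p : V -> 'rV[R]_3) (o : V -> V -> V -> V -> bool)
  (K : {set {set V}}) (j k T : {set V}).

(** The derivative of the dihedral angle of the tetrahedron [T] at its edge [j]
    with respect to the length of [k]. *)
Definition dihedral_rate p k j T : R :=
  derive1 (fun t : R => dihedral_at (set_length (edge_length p) k t) j T)
    (edge_length p k).

Lemma is_derive_dihedral_at p k u v x y :
    uniq [:: u; v; x; y] -> det4 p u v x y != 0 ->
  is_derive (edge_length p k) 1
    (fun t => dihedral_at (set_length (edge_length p) k t)
                [set u; v] [set u; v; x; y])
    (- angle_rate (sqlen_rate (edge_length p) k) p u v x y /
       (edge_length p [set u; v] * `|det4 p u v x y|)).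
Proof.
move=> U D0; under eq_fun => t do rewrite dihedral_atE //.
exact: is_derive_dihedral.
Qed.

Lemma dihedral_rateE p k u v x y :
    uniq [:: u; v; x; y] -> det4 p u v x y != 0 ->
  dihedral_rate p k [set u; v] [set u; v; x; y] =
  - angle_rate (sqlen_rate (edge_length p) k) p u v x y /
    (edge_length p [set u; v] * `|det4 p u v x y|).
Proof.
move=> U D0; rewrite /dihedral_rate derive1E.
exact: (@derive_val _ _ _ _ _ _ _ (is_derive_dihedral_at k U D0)).
Qed.

Lemma is_derive_bigsum (I : Type) (r : seq I) (f : I -> R -> R) (df : I -> R) (t : R) :
  (forall i, is_derive t 1 (f i) (df i)) ->
  is_derive t 1 (fun s => \sum_(i <- r) f i s) (\sum_(i <- r) df i).
Proof.
move=> Df; elim: r => [|i r IH].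
  under eq_fun do rewrite big_nil.
  by rewrite big_nil; exact: is_derive_cst.
under eq_fun do rewrite big_cons.
by rewrite big_cons; exact: is_derive_add.
Qed.

Lemma defect_derivativeE K o p j k : permitted K p -> #|j| = 2%N ->
  defect_derivative K o p j k =
  \sum_(T in tetrahedra K)
    if j \subset T then - orientation_sign o p T * dihedral_rate p k j T else 0.
Proof.
move=> Kp j2; rewrite /defect_derivative derive1E.
pose term T t := if (T \in tetrahedra K) && (j \subset T) then
  - orientation_sign o p T * dihedral_at (set_length (edge_length p) k t) j T else 0.
have -> : (fun t => defect_angle K o p (set_length (edge_length p) k t) j) =
    (fun t => \sum_T term T t).
  by apply/funext => t; rewrite /defect_angle big_mkcond.
rewrite -big_mkcondr big_mkcond /=.
apply: (@derive_val _ _ _ _ _ _ _ (is_derive_bigsum _ _)) => T; rewrite /term.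
case: ifP => [/andP[TK jT]|_]; last exact: is_derive_cst.
have T4 : #|T| = 4%N by move: TK; rewrite inE => /andP[_ /eqP].
have [u [v [x [y [U jE TE]]]]] := edge_tetrahedronP j2 T4 jT.
have D0 : det4 p u v x y != 0 by rewrite -(volume_gt0 p U) -TE Kp.
rewrite jE TE (dihedral_rateE _ U D0).
have H := is_derive_mul (is_derive_cst (- orientation_sign o p [set u; v; x; y])
  (edge_length p k) 1) (is_derive_dihedral_at k U D0).
by apply: is_derive_eq H _; rewrite mul0r add0r.
Qed.

End DefectDerivative.

(** * The tetrahedra on five points *)

Section FivePoints.
Context {R : realType} {V : finType}.
Variables (p : V -> 'rV[R]_3) (S : {set V}) (alpha : V -> R).
Hypothesis alpha_sum : \sum_(i in S) alpha i = 0.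
Hypothesis alpha_dep : \sum_(i in S) alpha i *: p i = 0.
Hypothesis alpha_neq0 : forall i, i \in S -> alpha i != 0.
Hypothesis nondegenerate : forall w x y z, uniq [:: w; x; y; z] ->
  [set w; x; y; z] \subset S -> det4 p w x y z != 0.
Let l := edge_length p.

(** The derivative with respect to the length of [k] of
    [\sum_(i, j) alpha_i * alpha_j * l_ij ^+ 2], the sum being over ordered
    pairs; here [alpha] is held fixed. *)
Definition dependency_rate (k : {set V}) : R :=
  \sum_(i in S) \sum_(j in S) alpha i * alpha j * sqlen_rate l k i j.

(** The derivative of the sum of the dihedral angles at [j] of the five
    tetrahedra with vertices in [S], that opposite to [i] taken with the sign
    of [alpha i]. *)
Definition boundary_rate (j k : {set V}) : R :=
  \sum_(i in S) if j \subset S :\ i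
    then Num.sg (alpha i) * dihedral_rate p k j (S :\ i) else 0.

Lemma big_set5 (A : nmodType) (F : V -> A) u v x y z :
  uniq [:: u; v; x; y; z] ->
  \sum_(i in [set u; v; x; y; z]) F i = F u + F v + F x + F y + F z.
Proof.
move=> U; rewrite (eq_bigl (mem [:: u; v; x; y; z])); last first.
  by move=> i; rewrite !inE !orbA.
by rewrite -big_uniq // !big_cons big_nil /= addr0 !addrA.
Qed.

(** The three tetrahedra around [uv] contribute the terms of
    [angle_rate_star]. *)
Lemma boundary_rateE u v x y z k : uniq [:: u; v; x; y; z] ->
    S = [set u; v; x; y; z] ->
  boundary_rate [set u; v] k =
  l [set u; v] * `|alpha z| / (4 * `|det4 p u v x y| * alpha x * alpha y * alpha z)
    * dependency_rate k.
Proof.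
move=> U SE; move: (U); rewrite /= !inE !negb_or -!andbA andbT.
move=> /and5P[uv ux uy uz] /and5P[vx vy vz xy] /andP[xz yz].
have N := (negbTE uv, negbTE ux, negbTE uy, negbTE uz, negbTE vx, negbTE vy,
  negbTE vz, negbTE xy, negbTE xz, negbTE yz).
have N' := (eq_sym v u, eq_sym x u, eq_sym y u, eq_sym z u, eq_sym x v,
  eq_sym y v, eq_sym z v, eq_sym y x, eq_sym z x, eq_sym z y).
have Sx : x \in S by rewrite SE !inE eqxx !orbT.
have Sy : y \in S by rewrite SE !inE eqxx !orbT.
have Sz : z \in S by rewrite SE !inE eqxx !orbT.
have Sxy : S :\ z = [set u; v; x; y].
  apply/setP => i; rewrite SE !inE.
  by case: (eqVneq i z) => [->|_]; rewrite /= ?(N', N) ?orbF.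
have Syz : S :\ x = [set u; v; y; z].
  apply/setP => i; rewrite SE !inE.
  by case: (eqVneq i x) => [->|_]; rewrite /= ?(N', N) ?orbF.
have Szx : S :\ y = [set u; v; z; x].
  apply/setP => i; rewrite SE !inE.
  case: (eqVneq i y) => [->|_]; rewrite /= ?(N', N) ?orbF //.
  by rewrite -!orbA (orbC (i == x)).
have Uxy : uniq [:: u; v; x; y] by rewrite /= !inE !N.
have Uyz : uniq [:: u; v; y; z] by rewrite /= !inE !N.
have Uzx : uniq [:: u; v; z; x] by rewrite /= !inE !N' !N.
have Dxy : det4 p u v x y != 0 by rewrite nondegenerate // -Sxy subD1set.
have Dyz : det4 p u v y z != 0 by rewrite nondegenerate // -Syz subD1set.
have Dzx : det4 p u v z x != 0 by rewrite nondegenerate // -Szx subD1set.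
have [Qx Qy _] := proj_inner_gt0 Dxy; have [_ Qz _] := proj_inner_gt0 Dyz.
have sum0 : alpha u + alpha v + alpha x + alpha y + alpha z = 0.
  by rewrite -alpha_sum SE big_set5.
have dep : alpha v *: (p v - p u) + alpha x *: (p x - p u)
    + alpha y *: (p y - p u) + alpha z *: (p z - p u) = 0.
  have := alpha_dep; rewrite SE big_set5 // => dep.
  have -> : alpha v *: (p v - p u) + alpha x *: (p x - p u)
      + alpha y *: (p y - p u) + alpha z *: (p z - p u) =
    (alpha u *: p u + alpha v *: p v + alpha x *: p x + alpha y *: p y
      + alpha z *: p z)
    - (alpha u + alpha v + alpha x + alpha y + alpha z) *: p u.
    by apply/rowP => i; rewrite !mxE; ring.
  by rewrite dep sum0 scale0r subrr.
have star := angle_rate_star (m := sqlen_rate l k) (sqlen_rateC l k)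
  (sqlen_ratexx p k) sum0 dep (alpha_neq0 Sx) (alpha_neq0 Sy) (alpha_neq0 Sz)
  (lt0r_neq0 Qx) (lt0r_neq0 Qy) (lt0r_neq0 Qz).
have ML : alpha u * alpha v * sqlen_rate l k u v + alpha u * alpha x * sqlen_rate l k u x
    + alpha u * alpha y * sqlen_rate l k u y + alpha u * alpha z * sqlen_rate l k u z
    + alpha v * alpha x * sqlen_rate l k v x + alpha v * alpha y * sqlen_rate l k v y
    + alpha v * alpha z * sqlen_rate l k v z + alpha x * alpha y * sqlen_rate l k x y
    + alpha x * alpha z * sqlen_rate l k x z + alpha y * alpha z * sqlen_rate l k y z
    = dependency_rate k / 2.
  rewrite /dependency_rate SE big_set5 // !big_set5 // !sqlen_ratexx.
  rewrite !(sqlen_rateC l k _ u) (sqlen_rateC l k x v) !(sqlen_rateC l k y v).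
  rewrite (sqlen_rateC l k z v) !(sqlen_rateC l k y x) (sqlen_rateC l k z x).
  by rewrite (sqlen_rateC l k z y); field.
rewrite ML in star.
have terms : boundary_rate [set u; v] k =
    Num.sg (alpha z) * dihedral_rate p k [set u; v] [set u; v; x; y]
    + Num.sg (alpha x) * dihedral_rate p k [set u; v] [set u; v; y; z]
    + Num.sg (alpha y) * dihedral_rate p k [set u; v] [set u; v; z; x].
  rewrite /boundary_rate {1}SE big_set5 // Sxy Syz Szx !subUset !sub1set !inE.
  by rewrite !N' !N !eqxx /= !andbF !add0r addrC addrA.
have lpos : l [set u; v] != 0.
  rewrite -sqrf_eq0 edge_length_sqr //.
  by rewrite gt_eqF // -/(inner p u v v) inner_gt0 // (det4_neq Dxy).
have h : inner p u v v = l [set u; v] ^+ 2 by rewrite edge_length_sqr.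
have sgE i : i \in S -> Num.sg (alpha i) = `|alpha i| / alpha i.
  by move=> iS; rewrite normrEsg mulfK // alpha_neq0.
(* The volumes of the tetrahedra around uv are proportional to the
   coefficients of the dependency at the opposite vertices. *)
have vol1 : `|det4 p u v z x| = `|alpha y| * `|det4 p u v x y| / `|alpha z|.
  have [_ _ ->] := det4_swap p u v x z.
  rewrite normrN -normrM [in RHS]det4E (triple_dependent dep) normrN normrM.
  by rewrite mulrC mulKf // normr_eq0 alpha_neq0.
have vol2 : `|det4 p u v y z| = `|alpha x| * `|det4 p u v x y| / `|alpha z|.
  have [_ _ ->] := det4_swap p u v y x.
  rewrite (addrAC (_ *: _)) in dep.
  rewrite normrN -normrM [in RHS]det4E (triple_dependent dep) normrN normrM.
  by rewrite mulrC mulKf // normr_eq0 alpha_neq0.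
rewrite terms !dihedral_rateE // !sgE // vol1 vol2.
have n0 i : i \in S -> `|alpha i| != 0 by move=> iS; rewrite normr_eq0 alpha_neq0.
have D0 : `|det4 p u v x y| != 0 by rewrite normr_eq0.
transitivity (- (`|alpha z| / (l [set u; v] * `|det4 p u v x y|)) *
  (angle_rate (sqlen_rate l k) p u v x y / alpha z
   + angle_rate (sqlen_rate l k) p u v y z / alpha x
   + angle_rate (sqlen_rate l k) p u v z x / alpha y)).
  by rewrite -/l; field; rewrite !alpha_neq0 // !n0 // lpos D0.
by rewrite star h; field; rewrite !alpha_neq0 // lpos D0.
Qed.

(** All rows of [boundary_rate] are proportional to [dependency_rate]. *)
Lemma boundary_rate_proportional (j k k' : {set V}) : #|S| = 5%N -> #|j| = 2%N ->
  boundary_rate j k * dependency_rate k' = boundary_rate j k' * dependency_rate k.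
Proof.
move=> S5 /eqP/cards2P[u [v [uv ->]]].
have [jS|jS] := boolP ([set u; v] \subset S); last first.
  have r0 m : boundary_rate [set u; v] m = 0.
    rewrite /boundary_rate big1 // => i iS; case: ifP => // ji.
    by rewrite (fintype.subset_trans ji) ?subD1set in jS.
  by rewrite !r0 !mul0r.
have D3 : #|S :\: [set u; v]| = 3%N.
  by have := cardsID [set u; v] S; rewrite (setIidPr jS) cards2 uv S5 => -[].
have /card_gt0P[x xD] : (0 < #|S :\: [set u; v]|)%N by rewrite D3.
have : #|(S :\: [set u; v]) :\ x| == 2%N.
  by have := cardsD1 x (S :\: [set u; v]); rewrite xD D3 add1n => -[<-].
move=> /cards2P[y [z [yz E]]].
have yE : y \in (S :\: [set u; v]) :\ x by rewrite E !inE eqxx.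
have zE : z \in (S :\: [set u; v]) :\ x by rewrite E !inE eqxx orbT.
have SE : S = [set u; v; x; y; z].
  rewrite -(setID S [set u; v]) (setIidPr jS) -(setD1K xD) E.
  by apply/setP => i; rewrite !inE !orbA.
move: xD yE zE; rewrite !inE !negb_or => /andP[/andP[xu xv] _].
move=> /and3P[yx /andP[yu yv] _] /and3P[zx /andP[zu zv] _].
have U : uniq [:: u; v; x; y; z].
  rewrite /= !inE !negb_or uv yz !(eq_sym u) !(eq_sym v) (eq_sym x y) (eq_sym x z).
  by rewrite xu xv yu yv zu zv yx zx.
by rewrite !(boundary_rateE _ U SE) mulrAC.
Qed.

End FivePoints.

(** * Determinants of principal submatrices *)

Section PrincipalMinors.
Context {R : comNzRingType} {I : finType}.
Implicit Types (F : I -> I -> R) (C : {set I}).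

(** The principal submatrix of [F] on [C]. *)
Definition principal F C : 'M[R]_#|C| :=
  \matrix_(i, j) F (enum_val i) (enum_val j).

(** A principal minor does not depend on the enumeration of the indices. *)
Lemma det_principal_reindex F C n (e : 'I_n -> I) : injective e ->
    (forall i, (i \in C) = (i \in codom e)) ->
  \det (\matrix_(i, j) F (e i) (e j)) = \det (principal F C).
Proof.
move=> e_inj eC.
have En : n = #|C|.
  by rewrite (eq_card eC) card_codom // card_ord.
have eP i : e i \in C by rewrite eC codom_f.
subst n.
pose f i := enum_rank_in (eP i) (e i).
have fK i : enum_val (f i) = e i by rewrite /f enum_rankK_in.
have f_inj : injective f by move=> i j /(congr1 enum_val); rewrite !fK => /e_inj.
have -> : \matrix_(i, j) F (e i) (e j) =
    row_perm (perm.perm f_inj) (col_perm (perm.perm f_inj) (principal F C)).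
  by apply/matrixP => i j; rewrite !mxE !perm.permE !fK.
rewrite row_permE col_permE !det_mulmx !det_perm perm.odd_permV mulrCA.
by rewrite -signr_addb addbb expr0 mulr1.
Qed.

(** Adding an index [i0] whose row is a multiple [L] of its diagonal entry, and
    changing the other rows by multiples of [L], multiplies a principal minor
    by that entry. *)
Lemma det_principal_add F F' C (i0 : I) (L : I -> R) : i0 \notin C ->
    (forall k, k \in C -> F' i0 k = F' i0 i0 * L k) ->
    (forall j k, j \in C -> k \in C -> F' j k = F j k + F' j i0 * L k) ->
  \det (principal F' (i0 |: C)) = F' i0 i0 * \det (principal F C).
Proof.
move=> i0C Frow Fblock.
pose e (i : 'I_(1 + #|C|)) := if fintype.split i is inr j then enum_val j else i0.
have e_l i : e (lshift _ i) = i0 by rewrite /e -/(unsplit (inl i)) unsplitK.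
have e_r i : e (rshift _ i) = enum_val i by rewrite /e -/(unsplit (inr i)) unsplitK.
rewrite -(@det_principal_reindex F' _ _ e); first last.
- move=> i; rewrite !inE; apply/orP/codomP => [[/eqP ->|iC]|[j ->]].
  + by exists (lshift _ ord0); rewrite e_l.
  + by exists (rshift _ (enum_rank_in iC i)); rewrite e_r enum_rankK_in.
  + by rewrite /e; case: (fintype.split j) => j'; [left|right; rewrite enum_valP].
- move=> i j; rewrite -(splitK i) -(splitK j).
  case: (fintype.split i) (fintype.split j) => [i'|i'] [j'|j'] /=; rewrite ?e_l ?e_r.
  + by rewrite !ord1.
  + by move=> E; rewrite E enum_valP in i0C.
  + by move=> E; rewrite -E enum_valP in i0C.
  + by move=> /enum_val_inj ->.
pose Lrow : 'rV[R]_#|C| := \row_j L (enum_val j).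
pose Fcol : 'cV[R]_#|C| := \col_j F' (enum_val j) i0.
have -> : \matrix_(i, j) F' (e i) (e j) =
    block_mx (F' i0 i0)%:M 0 Fcol (principal F C) *m block_mx 1%:M Lrow 0 1%:M.
  rewrite mulmx_block !mulmx1 !mulmx0 !addr0.
  apply/matrixP => i j; rewrite -(splitK i) -(splitK j).
  case: (fintype.split i) (fintype.split j) => [i'|i'] [j'|j'] /=.
  - by rewrite block_mxEul !mxE !e_l !ord1 eqxx mulr1n.
  - by rewrite block_mxEur mul_scalar_mx !mxE e_l e_r Frow ?enum_valP.
  - by rewrite block_mxEdl !mxE e_l e_r.
  - rewrite block_mxEdr !mxE big_ord1 !e_r !mxE Fblock ?enum_valP //.
    by rewrite addrC.
by rewrite det_mulmx det_lblock det_ublock !det1 det_scalar1 !mulr1.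
Qed.

End PrincipalMinors.

(** * Genericity *)

Section Genericity.
Context {R : realType} {V : finType}.
Implicit Types (p : V -> 'rV[R]_3).

Lemma generically_neq0 (q : mpoly.mpoly #|{: V * 'I_3}| R)
    (P : (V -> 'rV[R]_3) -> Prop) :
  (exists p, mpoly.meval (coordinates p) q != 0) ->
  (forall p, mpoly.meval (coordinates p) q != 0 -> P p) -> generically P.
Proof.
move=> [p0 p0q] qP; exists [set p | mpoly.meval (coordinates p) q = 0]%classic.
  split; last by exists p0 => /= /eqP; rewrite (negbTE p0q).
  exists [set q]%classic => p; split=> /= [E _ -> //|]; exact.
by move=> p /= /eqP; apply: qP.
Qed.

Lemma det4_polynomial a b c d : exists q : mpoly.mpoly #|{: V * 'I_3}| R,
  forall p, mpoly.meval (coordinates p) q = det4 p a b c d.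
Proof.
pose X (v : V) : 'rV[mpoly.mpoly #|{: V * 'I_3}| R]_3 :=
  \row_j mpoly.mpolyX R (mpoly.mnm1 (enum_rank (v, j))).
exists (\det (\matrix_(i < 3) [:: X b - X a; X c - X a; X d - X a]`_i)) => p.
rewrite -det_map_mx /det4; congr (\det _); apply/matrixP => i j; rewrite !mxE.
case: i => [[|[|[|//]]] ?] /=; rewrite !mxE raddfB /= !mpoly.mevalXU;
  by rewrite /coordinates !enum_rankK.
Qed.

End Genericity.

(** * The Pachner move *)

Section Move.
Context {R : realType} {V : finType}.
Variables (K : {set {set V}}) (o : V -> V -> V -> V -> bool) (a b c d e : V).
Hypothesis K_complex : is_complex K.
Hypothesis o_consistent : consistent_orientation K o.
Hypothesis move : pachner23_applicable K a b c d e.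

Implicit Types (p : V -> 'rV[R]_3) (T j k : {set V}).

Let K' := pachner23 K a b c d e.
Let o' := pachner23_orientation o a b c d e.
Let S : {set V} := [set a; b; c; d; e].

Let U5 : uniq [:: a; b; c; d; e]. Proof. by case: move. Qed.

Let neqs : (((a == b) = false) * ((a == c) = false) * ((a == d) = false)
  * ((a == e) = false) * ((b == c) = false) * ((b == d) = false)
  * ((b == e) = false) * ((c == d) = false) * ((c == e) = false)
  * ((d == e) = false)) *
  (((b == a) = false) * ((c == a) = false) * ((d == a) = false)
  * ((e == a) = false) * ((c == b) = false) * ((d == b) = false)
  * ((e == b) = false) * ((d == c) = false) * ((e == c) = false)
  * ((e == d) = false)).
Proof.
have := U5; rewrite /= !inE !negb_or -!andbA andbT.
move=> /and5P[ab ac ad ae] /and5P[bc bd be cd] /andP[ce de].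
by do !split; apply/negbTE; rewrite // eq_sym.
Qed.

Let de_notin T : T \in K -> ~~ ((d \in T) && (e \in T)).
Proof.
move=> TK; apply/negP => /andP[dT eT]; case: move => _ _ _ /negP; apply.
case: K_complex => _ _ /(_ T _ TK); apply; first by rewrite subUset !sub1set dT eT.
by apply/set0Pn; exists d; rewrite !inE eqxx.
Qed.

Let abcdK : [set a; b; c; d] \in K. Proof. by case: move. Qed.
Let abceK : [set a; b; c; e] \in K. Proof. by case: move. Qed.

Let Uabcd : uniq [:: a; b; c; d].
Proof. by rewrite /= !inE !neqs. Qed.
Let Uabce : uniq [:: a; b; c; e].
Proof. by rewrite /= !inE !neqs. Qed.
Let Uabde : uniq [:: a; b; d; e].
Proof. by rewrite /= !inE !neqs. Qed.
Let Ubcde : uniq [:: b; c; d; e].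
Proof. by rewrite /= !inE !neqs. Qed.
Let Ucade : uniq [:: c; a; d; e].
Proof. by rewrite /= !inE !neqs. Qed.

(** The tetrahedra that the move keeps. *)
Definition kept_tetrahedra : {set {set V}} :=
  tetrahedra K :\: [set [set a; b; c; d]; [set a; b; c; e]].

Lemma big_tetrahedra (A : Type) (idx : A) (op : Monoid.com_law idx)
    (F : {set V} -> A) :
  \big[op/idx]_(T in tetrahedra K) F T =
  op (F [set a; b; c; d]) (op (F [set a; b; c; e])
    (\big[op/idx]_(T in kept_tetrahedra) F T)).
Proof.
have ne : [set a; b; c; d] != [set a; b; c; e].
  by apply/negP => /eqP/setP/(_ d); rewrite !inE !eqxx !neqs.
have -> : tetrahedra K =
    [set a; b; c; d] |: ([set a; b; c; e] |: kept_tetrahedra).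
  apply/setP => T; rewrite !inE.
  case: (eqVneq T [set a; b; c; d]) => [->|_] /=; first by rewrite abcdK card_set4.
  by case: (eqVneq T [set a; b; c; e]) => [->|_] //=; rewrite abceK card_set4.
by rewrite !big_setU1 //= !inE ?eqxx ?orbT // negb_or ne.
Qed.

Let card_set3_neq (x y z : V) : #|[set x; y; z]| == 4%N = false.
Proof.
apply/negbTE; rewrite neq_ltn; apply/orP; left; rewrite ltnS.
apply: leq_trans (leq_of_leqif (leq_card_setU _ _)) _.
by rewrite cards1 cards2; case: (_ != _).
Qed.

Lemma big_tetrahedra_pachner (A : Type) (idx : A) (op : Monoid.com_law idx)
    (F : {set V} -> A) :
  \big[op/idx]_(T in tetrahedra K') F T =
  op (F [set a; b; d; e]) (op (F [set b; c; d; e]) (op (F [set c; a; d; e])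
    (\big[op/idx]_(T in kept_tetrahedra) F T))).
Proof.
have new_kept (T : {set V}) : d \in T -> e \in T -> T \notin kept_tetrahedra.
  move=> dT eT; rewrite !inE; apply/negP => /andP[_ /andP[TK _]].
  by have := de_notin TK; rewrite dT eT.
have ne1 : [set a; b; d; e] != [set b; c; d; e].
  by apply/negP => /eqP/setP/(_ a); rewrite !inE !eqxx !neqs.
have ne2 : [set a; b; d; e] != [set c; a; d; e].
  by apply/negP => /eqP/setP/(_ b); rewrite !inE !eqxx !neqs.
have ne3 : [set b; c; d; e] != [set c; a; d; e].
  by apply/negP => /eqP/setP/(_ b); rewrite !inE !eqxx !neqs.
have -> : tetrahedra K' = [set a; b; d; e] |: ([set b; c; d; e] |:
    ([set c; a; d; e] |: kept_tetrahedra)).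
  apply/setP => T; rewrite !inE -!orbA.
  case: (eqVneq T [set a; b; d; e]) => [->|_] /=; first by rewrite card_set4 // !orbT.
  case: (eqVneq T [set b; c; d; e]) => [->|_] /=; first by rewrite card_set4 // !orbT.
  case: (eqVneq T [set c; a; d; e]) => [->|_] /=; first by rewrite card_set4 // !orbT.
  case: (eqVneq T [set d; e]) => [->|_] /=.
    by rewrite cards2 neqs !andbF.
  case: (eqVneq T [set a; d; e]) => [->|_] /=; first by rewrite card_set3_neq !andbF.
  case: (eqVneq T [set b; d; e]) => [->|_] /=; first by rewrite card_set3_neq !andbF.
  case: (eqVneq T [set c; d; e]) => [->|_] /=; first by rewrite card_set3_neq !andbF.
  case: (eqVneq T [set a; b; c]) => [->|_] /=; first by rewrite card_set3_neq !andbF.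
  by rewrite !orbF -andbA.
have n1 : [set a; b; d; e] \notin kept_tetrahedra.
  by apply: new_kept; rewrite !inE eqxx ?orbT.
have n2 : [set b; c; d; e] \notin kept_tetrahedra.
  by apply: new_kept; rewrite !inE eqxx ?orbT.
have n3 : [set c; a; d; e] \notin kept_tetrahedra.
  by apply: new_kept; rewrite !inE eqxx ?orbT.
rewrite big_setU1 /=; last by rewrite !in_setU1 !negb_or ne1 ne2 n1.
rewrite big_setU1 /=; last by rewrite !in_setU1 !negb_or ne3 n2.
by rewrite big_setU1.
Qed.

Lemma edges_pachner : edges K' = [set d; e] |: edges K.
Proof.
apply/setP => T; rewrite !inE -!orbA.
case: (eqVneq T [set d; e]) => [->|_] /=; first by rewrite cards2 neqs orbT.
have card3 x y z : uniq [:: x; y; z] -> #|[set x; y; z]| == 2%N = false.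
  move=> U; rewrite [#|_|](_ : _ = 3%N) //; apply: etrans (card_uniqP U).
  by apply: eq_card => i; rewrite !inE !orbA.
have card4 x y z w : uniq [:: x; y; z; w] -> #|[set x; y; z; w]| == 2%N = false.
  by move=> U; rewrite card_set4.
case: (eqVneq T [set a; d; e]) => [->|_] /=.
  by rewrite card3 ?andbF // /= !inE !neqs.
case: (eqVneq T [set b; d; e]) => [->|_] /=.
  by rewrite card3 ?andbF // /= !inE !neqs.
case: (eqVneq T [set c; d; e]) => [->|_] /=.
  by rewrite card3 ?andbF // /= !inE !neqs.
case: (eqVneq T [set a; b; d; e]) => [->|_] /=; first by rewrite card4 ?andbF.
case: (eqVneq T [set b; c; d; e]) => [->|_] /=; first by rewrite card4 ?andbF.
case: (eqVneq T [set c; a; d; e]) => [->|_] /=; first by rewrite card4 ?andbF.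
case: (eqVneq T [set a; b; c]) => [->|_] /=.
  by rewrite card3 ?andbF // /= !inE !neqs.
case: (eqVneq T [set a; b; c; d]) => [->|_] /=; first by rewrite card4 ?andbF.
case: (eqVneq T [set a; b; c; e]) => [->|_] /=; first by rewrite card4 ?andbF.
by rewrite orbF.
Qed.

Lemma de_edges : [set d; e] \notin edges K.
Proof.
rewrite inE; apply/negP => /andP[/de_notin].
by rewrite !inE !eqxx orbT.
Qed.

Let in_move (T : {set V}) :
  T \in [:: [set a; b; d; e]; [set b; c; d; e]; [set c; a; d; e]] ->
  T \in K'.
Proof. by rewrite !inE => /or3P[] ->; rewrite !orbT. Qed.

Let S_minus : ((S :\ a = [set b; c; d; e]) * (S :\ b = [set c; a; d; e])
  * (S :\ c = [set a; b; d; e]) * (S :\ d = [set a; b; c; e])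
  * (S :\ e = [set a; b; c; d]))%type.
Proof.
do !split; apply/setP => i; rewrite !inE.
- by case: (eqVneq i a) => [->|_]; rewrite ?neqs.
- case: (eqVneq i b) => [->|_]; rewrite ?neqs //= orbF.
  by rewrite (orbC (i == c)).
- by case: (eqVneq i c) => [->|_]; rewrite ?neqs //= orbF.
- by case: (eqVneq i d) => [->|_]; rewrite ?neqs //= orbF.
- by case: (eqVneq i e) => [->|_]; rewrite ?neqs //= orbF.
Qed.

(** The coefficients of the affine dependency of the five points: signed
    volumes, times [6], of the opposite tetrahedra; [0] at other vertices. *)
Definition dependency (p : V -> 'rV[R]_3) (i : V) : R :=
  if i == a then det4 p b c d e else if i == b then det4 p c a d e
  else if i == c then det4 p a b d e else if i == d then - det4 p a b c e
  else if i == e then det4 p a b c d else 0.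

Let dependencyE p : ((dependency p a = det4 p b c d e)
  * (dependency p b = det4 p c a d e) * (dependency p c = det4 p a b d e)
  * (dependency p d = - det4 p a b c e) * (dependency p e = det4 p a b c d))%type.
Proof. by rewrite /dependency !eqxx !neqs. Qed.

Lemma dependency_sum p : \sum_(i in S) dependency p i = 0.
Proof.
rewrite big_set5 // !dependencyE !det4E !tripleE !mxE; ring.
Qed.

Lemma dependency_dep p : \sum_(i in S) dependency p i *: p i = 0.
Proof.
have shift (q : 'rV[R]_3) : \sum_(i in S) dependency p i *: p i =
    \sum_(i in S) dependency p i *: (p i - q).
  under [RHS]eq_bigr do rewrite scalerBr.
  by rewrite sumrB -scaler_suml dependency_sum scale0r subr0.
rewrite (shift (p d)) big_set5 // subrr scaler0 addr0 !dependencyE.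
have -> : det4 p b c d e = triple (p e - p d) (p b - p d) (p c - p d).
  by rewrite det4E !tripleE !mxE; ring.
have -> : det4 p c a d e = triple (p e - p d) (p c - p d) (p a - p d).
  by rewrite det4E !tripleE !mxE; ring.
have -> : det4 p a b d e = triple (p e - p d) (p a - p d) (p b - p d).
  by rewrite det4E !tripleE !mxE; ring.
have -> : det4 p a b c d = - triple (p a - p d) (p b - p d) (p c - p d).
  by rewrite det4E !tripleE !mxE; ring.
by rewrite addrC !addrA triple_cramer.
Qed.

Lemma orientation_sign_kept p T : T \in kept_tetrahedra ->
  orientation_sign o' p T = orientation_sign o p T.
Proof.
rewrite !inE => /andP[_ /andP[/de_notin]]; rewrite /orientation_sign -!(mem_enum T).
case: (enum T) => [|w [|x [|y [|z [|]]]]] //= /negbTE deT _.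
by rewrite /o' /pachner23_orientation deT.
Qed.

(** Minus the sign of the ordering [a, b, c, d]. *)
Definition move_sign : R := (-1) ^+ o a b c d.

Let alt_abcd w x y z : perm_eq [:: w; x; y; z] [:: a; b; c; d] ->
  [/\ o x w y z = ~~ o w x y z, o w y x z = ~~ o w x y z &
      o w x z y = ~~ o w x y z].
Proof.
move=> P; apply: (proj1 o_consistent); first by rewrite (perm_uniq P) Uabcd.
rewrite [X in X \in K](_ : _ = [set a; b; c; d]) //.
by apply/setP => i; have := perm_mem P i; rewrite !inE !orbA.
Qed.

(** The five tetrahedra with vertices in [abcde], the old ones with reversed
    orientation, form the oriented boundary of a 4-simplex; so their signs are
    those of the coefficients of the dependency, up to a common factor. *)
Lemma move_orientation_signs p :
  [/\ orientation_sign o' p [set b; c; d; e] = move_sign * Num.sg (dependency p a),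
      orientation_sign o' p [set c; a; d; e] = move_sign * Num.sg (dependency p b),
      orientation_sign o' p [set a; b; d; e] = move_sign * Num.sg (dependency p c),
      orientation_sign o p [set a; b; c; e] = - (move_sign * Num.sg (dependency p d)) &
      orientation_sign o p [set a; b; c; d] = - (move_sign * Num.sg (dependency p e))].
Proof.
have C' := pachner23_orientation_consistent K_complex o_consistent move.
have perm4 w x y z :
    (forall q : pred V, count q [:: w; x; y; z] = count q [:: a; b; c; d]) ->
  perm_eq [:: w; x; y; z] [:: a; b; c; d] by move/permP.
have [A1 A2 A3] := alt_abcd (perm_refl _).
have [_ B2 _] : [/\ o a b c d = ~~ o b a c d, o b c a d = ~~ o b a c d &
    o b a d c = ~~ o b a c d].
  by apply/alt_abcd/perm4 => q /=; rewrite addnCA.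
have [_ _ B3] : [/\ o c b a d = ~~ o b c a d, o b a c d = ~~ o b c a d &
    o b c d a = ~~ o b c a d].
  by apply/alt_abcd/perm4 => q /=; rewrite [(q c + _)%N]addnCA addnCA.
have [D1 _ _] : [/\ o c a b d = ~~ o a c b d, o a b c d = ~~ o a c b d &
    o a c d b = ~~ o a c b d].
  by apply/alt_abcd/perm4 => q /=; rewrite [(q c + _)%N]addnCA.
have [_ _ D3] : [/\ o a c b d = ~~ o c a b d, o c b a d = ~~ o c a b d &
    o c a d b = ~~ o c a b d].
  by apply/alt_abcd/perm4 => q /=; rewrite addnCA [(q c + _)%N]addnCA.
have E : o a b c e = ~~ o a b c d by apply: (proj2 o_consistent).
rewrite !(orientation_signE _ o_consistent) //.
rewrite !(orientation_signE _ C') ?in_move ?inE ?eqxx ?orbT //.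
rewrite E !dependencyE /move_sign sgrN /pachner23_orientation /=.
rewrite !inE !eqxx !neqs /= ?orbT /= B3 B2 D3 D1 A1 A2 A3 !negbK.
by case: (o a b c d); rewrite /= !(expr0, expr1); split; ring.
Qed.

Lemma defect_derivative_move p j k : permitted K p -> permitted K' p ->
    #|j| = 2%N ->
  defect_derivative K' o' p j k =
  defect_derivative K o p j k - move_sign * boundary_rate p S (dependency p) j k.
Proof.
move=> Kp Kp' j2; rewrite !defect_derivativeE // big_tetrahedra big_tetrahedra_pachner /=.
have [-> -> -> -> ->] := move_orientation_signs p.
rewrite /boundary_rate big_set5 // !S_minus.
rewrite (eq_bigr (fun T => if j \subset T then
  - orientation_sign o p T * dihedral_rate p k j T else 0)); last first.
  by move=> T TK; rewrite orientation_sign_kept.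
move: (dihedral_rate p k j) (dependency p) => f g.
move: (f [set a; b; d; e]) (f [set b; c; d; e]) (f [set c; a; d; e]).
move: (f [set a; b; c; d]) (f [set a; b; c; e]) (\sum_(T in _) _) move_sign.
move: (Num.sg (g a)) (Num.sg (g b)) (Num.sg (g c)) (Num.sg (g d)) (Num.sg (g e)).
by move=> *; do 5!case: ifP => _; ring.
Qed.

(** * Invariance of the expression *)

Variable p : V -> 'rV[R]_3.
Hypothesis Kp : permitted K p.
Hypothesis D_abde : det4 p a b d e != 0.
Hypothesis D_bcde : det4 p b c d e != 0.
Hypothesis D_cade : det4 p c a d e != 0.

Let alpha := dependency p.
Let l := edge_length p.

Let D_abcd : det4 p a b c d != 0.
Proof. by rewrite -volume_gt0 // Kp // inE abcdK card_set4. Qed.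

Let D_abce : det4 p a b c e != 0.
Proof. by rewrite -volume_gt0 // Kp // inE abceK card_set4. Qed.

Lemma permitted_move : permitted K' p.
Proof.
have : \big[andb/true]_(T in tetrahedra K') (0 < volume p T).
  rewrite big_tetrahedra_pachner /= !volume_gt0 // D_abde D_bcde D_cade /=.
  rewrite big_andE; apply/forall_inP => T; rewrite in_setD => /andP[_].
  exact: Kp.
by rewrite big_andE => /forall_inP.
Qed.

Let alpha_neq0 i : i \in S -> alpha i != 0.
Proof.
by rewrite !inE -!orbA => /or4P[|||/orP[]] /eqP->;
  rewrite /alpha dependencyE ?oppr_eq0.
Qed.

Let card_S : #|S| = 5%N.
Proof.
apply: etrans (card_uniqP U5).
by apply: eq_card => i; rewrite !inE !orbA.
Qed.

Let nondegenerate w x y z : uniq [:: w; x; y; z] ->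
  [set w; x; y; z] \subset S -> det4 p w x y z != 0.
Proof.
move=> U TS; rewrite -volume_gt0 //; move: TS (card_set4 U).
set T := [set w; x; y; z] => TS T4.
have /eqP/cards1P[i iE] : #|S :\: T| = 1%N.
  by have := cardsID T S; rewrite (setIidPr TS) T4 card_S => -[].
have iS : i \in S by have : i \in S :\: T; [rewrite iE inE|rewrite inE => /andP[]].
have -> : T = S :\ i by rewrite -iE setDDr setDv set0U (setIidPr TS).
by move: iS; rewrite !inE -!orbA => /or4P[|||/orP[]] /eqP->;
  rewrite S_minus volume_gt0.
Qed.

Let de_length : l [set d; e] != 0.
Proof.
have de : p d != p e.
  apply: contraNneq D_abde => E; rewrite det4E E tripleE; apply/eqP; ring.
by rewrite -sqrf_eq0 edge_length_sqr ?neqs // gt_eqF // dot_gt0 // subr_eq0 eq_sym.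
Qed.

Let dependency_rate_de :
  dependency_rate p S alpha [set d; e] = 4 * alpha d * alpha e * l [set d; e].
Proof.
rewrite /dependency_rate big_set5 // !big_set5 // /sqlen_rate !set2_eq !neqs !eqxx /=.
rewrite (setUC [set e] [set d]) -/l !mulr0 !mulr1 !(addr0, add0r); ring.
Qed.

Let boundary_rate_de : boundary_rate p S alpha [set d; e] [set d; e] =
  l [set d; e] ^+ 2 * (alpha d * alpha e) / (alpha a * alpha b * alpha c).
Proof.
have U : uniq [:: d; e; a; b; c] by rewrite /= !inE !neqs.
have SE : S = [set d; e; a; b; c].
  apply/setP => i; rewrite !inE.
  by case: (i == a) (i == b) (i == c) (i == d) (i == e) => [] [] [] [] [].
rewrite (boundary_rateE (dependency_sum p) (dependency_dep p) alpha_neq0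
  nondegenerate _ U SE) dependency_rate_de.
have -> : det4 p d e a b = alpha c.
  by rewrite /alpha dependencyE !det4E !tripleE !mxE; ring.
have c0 : alpha c != 0 by rewrite alpha_neq0 // !inE eqxx ?orbT.
have b0 : alpha b != 0 by rewrite alpha_neq0 // !inE eqxx ?orbT.
have a0 : alpha a != 0 by rewrite alpha_neq0 // !inE eqxx ?orbT.
have c0' : `|alpha c| != 0 by rewrite normr_eq0.
by rewrite -/alpha -/l; field; rewrite a0 b0 c0 c0'.
Qed.

(* No old tetrahedron contains the new edge: the old defect angles do not depend
   on its length, and the old defect angle at it is an empty sum. *)
Let old_row_de k : defect_derivative K o p [set d; e] k = 0.
Proof.
rewrite defect_derivativeE // ?cards2 ?neqs // big1 // => T.
rewrite inE => /andP[/de_notin deT _].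
by rewrite subUset !sub1set (negbTE deT).
Qed.

Let old_col_de j : #|j| = 2%N -> defect_derivative K o p j [set d; e] = 0.
Proof.
move=> j2; rewrite defect_derivativeE // big1 // => T TK; case: ifP => // jT.
have /andP[/de_notin deT /eqP T4] : (T \in K) && (#|T| == 4%N) by rewrite inE in TK.
have [u [v [x [y [U jE TE]]]]] := edge_tetrahedronP j2 T4 jT.
have D0 : det4 p u v x y != 0 by rewrite -volume_gt0 // -TE Kp.
have z i i' : i \in T -> i' \in T -> sqlen_rate l [set d; e] i i' = 0.
  move=> iT i'T; rewrite /sqlen_rate set2_eq.
  case: eqP => [E|_] /=; [case: eqP => [E'|_] /=|].
  - by move: deT; rewrite -E -E' iT i'T.
  - case: eqP => [E1|_] /=; last by rewrite mulr0.
    case: eqP => [E2|_] /=; last by rewrite mulr0.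
    by move: deT; rewrite -E1 -E2 iT i'T.
  - case: eqP => [E1|_] /=; last by rewrite mulr0.
    case: eqP => [E2|_] /=; last by rewrite mulr0.
    by move: deT; rewrite -E1 -E2 iT i'T.
rewrite jE TE dihedral_rateE //.
suff -> : angle_rate (sqlen_rate (edge_length p) [set d; e]) p u v x y = 0.
  by rewrite oppr0 mul0r mulr0.
rewrite /angle_rate /proj_rate /inner_rate -/l.
rewrite !z ?TE ?inE ?eqxx ?orbT //.
by rewrite !(addr0, subr0, mul0r, mulr0).
Qed.

(** The new matrix is the old one, bordered by zeros, plus a matrix of rank one
    whose columns are multiples of the column of the new edge. *)
Lemma det_submatrix_move (C : {set {set V}}) : C \subset edges K ->
  \det (submatrix K' o' p ([set d; e] |: C)) =
  - move_sign * (l [set d; e] ^+ 2 * (alpha d * alpha e) / (alpha a * alpha b * alpha c))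
  * \det (submatrix K o p C).
Proof.
move=> CK; have Kp' := permitted_move.
have de2 : #|[set d; e]| = 2%N by rewrite cards2 neqs.
have C2 j : j \in C -> #|j| = 2%N.
  by move=> /(fintype.subsetP CK); rewrite inE => /andP[_ /eqP].
have M0 : dependency_rate p S alpha [set d; e] != 0.
  by rewrite dependency_rate_de !mulf_neq0 ?alpha_neq0 ?pnatr_eq0 // !inE eqxx ?orbT.
have prop j k : #|j| = 2%N -> boundary_rate p S alpha j k =
    boundary_rate p S alpha j [set d; e] *
    (dependency_rate p S alpha k / dependency_rate p S alpha [set d; e]).
  move=> j2; rewrite mulrA; apply: (canRL (mulfK M0)).
  exact: (boundary_rate_proportional (dependency_sum p) (dependency_dep p)).
have corner : defect_derivative K' o' p [set d; e] [set d; e] =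
    - move_sign * (l [set d; e] ^+ 2 * (alpha d * alpha e) / (alpha a * alpha b * alpha c)).
  by rewrite defect_derivative_move // old_row_de -/alpha boundary_rate_de sub0r mulNr.
rewrite -corner; apply: (@det_principal_add _ _ (defect_derivative K o p)
  (defect_derivative K' o' p) _ _
  (fun k => dependency_rate p S alpha k / dependency_rate p S alpha [set d; e])).
- by apply: contra (fintype.subsetP CK _) de_edges.
- move=> k kC; rewrite !(defect_derivative_move _ _ Kp') // !old_row_de -/alpha.
  by rewrite (prop _ k) // !sub0r !mulNr mulrA.
- move=> j k jC kC; rewrite !(defect_derivative_move _ _ Kp') ?C2 // -/alpha.
  by rewrite (old_col_de (C2 _ jC)) (prop _ k) ?C2 // sub0r mulNr mulrA.
Qed.

Lemma expression_move (C : {set {set V}}) : C \subset edges K ->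
  expression K' o' ([set d; e] |: C) p = expression K o C p \/
  expression K' o' ([set d; e] |: C) p = - expression K o C p.
Proof.
move=> CK; rewrite /expression det_submatrix_move // edges_pachner.
rewrite big_setU1 ?de_edges //= big_tetrahedra big_tetrahedra_pachner /=.
rewrite !volumeE // !(mulrCA 6) !mulfV ?pnatr_eq0 // !mulr1 -/l.
have [Va [Vb Vc]] : `|det4 p b c d e| = `|alpha a| /\ `|det4 p c a d e| = `|alpha b| /\
    `|det4 p a b d e| = `|alpha c| by rewrite /alpha !dependencyE.
have [Vd Ve] : `|det4 p a b c e| = `|alpha d| /\ `|det4 p a b c d| = `|alpha e|.
  by rewrite /alpha !dependencyE normrN.
rewrite {}Va {}Vb {}Vc {}Vd {}Ve [(_ ^+ 2 * _)^-1]invfM.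
have [a0 b0 c0] : [/\ alpha a != 0, alpha b != 0 & alpha c != 0].
  by split; rewrite alpha_neq0 // !inE eqxx ?orbT.
move: (\prod_(T in kept_tetrahedra) _) (\prod_(j in edges K) _)^-1 => P q.
move: (\det _) de_length => D; move: (l _) => lde lde0.
move: (alpha a) (alpha b) (alpha c) (alpha d) (alpha e) a0 b0 c0.
move=> xa xb xc xd xe a0 b0 c0.
have B0 : xa * xb * xc != 0 by rewrite !mulf_neq0.
have -> : - move_sign * (lde ^+ 2 * (xd * xe) / (xa * xb * xc)) * D * (lde ^- 2 * q) *
    (`|xc| * (`|xa| * (`|xb| * P))) =
    - move_sign * (`|xa * xb * xc| / (xa * xb * xc)) * (xd * xe * (D * q * P)).
  by rewrite !normrM; field; rewrite lde0 a0 b0 c0.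
have -> : D * q * (`|xe| * (`|xd| * P)) = `|xd * xe| * (D * q * P).
  by rewrite normrM; ring.
have [] : - move_sign * (`|xa * xb * xc| / (xa * xb * xc)) = 1 \/
    - move_sign * (`|xa * xb * xc| / (xa * xb * xc)) = -1.
- move: (xa * xb * xc) B0 => B B0; rewrite /move_sign.
  case: (ger0P B) => _; rewrite !mulNr ?mulrN divff // mulr1;
  by case: (o a b c d); rewrite ?expr0 ?expr1 ?opprK; auto.
- by move=> ->; case: (ger0P (xd * xe)) => _; [left|right]; rewrite mul1r ?mulNr ?opprK.
- by move=> ->; case: (ger0P (xd * xe)) => _; [right|left]; rewrite ?mulNr mul1r ?opprK.
Qed.

End Move.

Theorem theorem3 (R : realType) (V : finType) (K : {set {set V}})
    (o : V -> V -> V -> V -> bool) (C : {set {set V}}) (a b c d e : V)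
    (K_manifold : closed_PL_3manifold R K)
    (o_consistent : consistent_orientation K o)
    (C_admissible : admissible R K o C)
    (move : pachner23_applicable K a b c d e) :
  generically (fun p : V -> 'rV[R]_3 => permitted K p ->
    let K' := pachner23 K a b c d e in
    let o' := pachner23_orientation o a b c d e in
    let C' := [set d; e] |: C in
    expression K' o' C' p = expression K o C p \/
    expression K' o' C' p = - expression K o C p).
Proof.
have [K_complex _] := K_manifold; have [CK _] := C_admissible.
have [q1 q1E] := @det4_polynomial R V a b d e.
have [q2 q2E] := @det4_polynomial R V b c d e.
have [q3 q3E] := @det4_polynomial R V c a d e.
have qE p : mpoly.meval (coordinates p) (q1 * q2 * q3) =
    det4 p a b d e * det4 p b c d e * det4 p c a d e.
  by rewrite !rmorphM /= q1E q2E q3E.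
apply: (generically_neq0 (q := q1 * q2 * q3)).
  (* a at the origin, b, c, d at the unit vectors and e at (1, 1, 1). *)
  exists (fun v => \row_(j < 3) [:: (v \in [:: b; e])%:R; (v \in [:: c; e])%:R;
                                    (v \in [:: d; e])%:R]`_j).
  rewrite qE !det4E !tripleE !mxE /=.
  have [U _ _ _] := move; move: U; rewrite /= !inE !negb_or -!andbA andbT.
  move=> /and5P[ab ac ad ae] /and5P[bc bd be cd] /andP[ce de].
  rewrite !eqxx (eq_sym d c) (eq_sym d b) (eq_sym c b).
  rewrite !(negbTE ab, negbTE ac, negbTE ad, negbTE ae, negbTE bc, negbTE bd,
    negbTE be, negbTE cd, negbTE ce, negbTE de) /= ?orbT /=.
  by rewrite [X in X != 0](_ : _ = 2) ?pnatr_eq0 //; ring.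
move=> p; rewrite qE !mulf_eq0 !negb_or => /andP[/andP[D1 D2] D3] Kp /=.
exact: expression_move.
Qed.
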